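(* Let $(D,M)$ be a one-dimensional local domain whose integral closure $(\overline{D},\overline{M})$ is a finitely generated $D$-module. (1) If $\operatorname{char}D/M=0$, the following are equivalent: (a) $D$ is an AV-domain; (b) $D$ is an API-domain; (c) $D$ is a DVR; (d) $G(D)\cong\mathbb{Z}$. (2) If $\operatorname{char}D/M=p>0$, the following are equivalent: (a) $D$ is an AV-domain; (b) $D\subseteq\overline{D}$ is a root extension; (c) $D/M\subseteq\overline{D}/\overline{M}$ is a root extension; (d) $G(D)\cong T\oplus\mathbb{Z}$ with $T$ a torsion group. Also the following are equivalent: (a') $D$ is an API-domain; (b') $D\subseteq\overline{D}$ is a bounded root extension; (c') $D/M\subseteq\overline{D}/\overline{M}$ is a bounded root extension; (d') $G(D)\cong T\oplus\mathbb{Z}$ with $T$ a group of bounded order.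
   Context: Local means Noetherian with unique maximal ideal; $\overline{D}$ is the integral closure of $D$ in its quotient field $K$. The group of divisibility of $D$ is $G(D)=K^*/U(D)$, $U(D)$ the unit group (here isomorphisms are of abelian groups). AV-domain: for nonzero $a,b$ there is $n$ with $a^n\mid b^n$ or $b^n\mid a^n$. API-domain: for every nonempty subset $\{d_\alpha\}$ of nonzero elements there is $n$ with $(\{d_\alpha^n\})$ principal. A root extension $R\subseteq S$: each $s\in S$ has some power in $R$; bounded if one exponent works for all $s$. DVR: local PID not a field. *)

(* Defs.v *)
From HB Require Import structures.
From mathcomp Require Import all_boot all_order all_algebra.
Set Implicit Arguments. Unset Strict Implicit. Unset Printing Implicit Defensive.
Import Order.TTheory GRing.Theory Num.Theory.
Local Open Scope ring_scope.

(* A domain D is represented as a subring (Prop predicate) D of a field K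
   which is the quotient field of D. *)

Section Defs.
Variable K : fieldType.
Implicit Types (D I S : K -> Prop) (x y : K).

Definition subring D : Prop :=
  [/\ D 1, (forall x y, D x -> D y -> D (x - y)) &
      (forall x y, D x -> D y -> D (x * y))].

Definition is_frac_field D : Prop :=
  forall x, exists a b, [/\ D a, D b, b != 0 & x = a / b].

Definition unitD D x : Prop := [/\ D x, x != 0 & D x^-1].
(* non-units of D (the maximal ideal when D is local) *)
Definition nonunitD D x : Prop := D x /\ ~ unitD D x.

Definition dvdD D x y : Prop := exists c, D c /\ y = c * x.

Definition is_ideal D I : Prop :=
  [/\ (forall x, I x -> D x), I 0,
      (forall x y, I x -> I y -> I (x + y)) &
      (forall r x, D r -> I x -> I (r * x))].

Definition dspan D (s : seq K) x : Prop :=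
  exists r : seq K, [/\ size r = size s, (forall i, (i < size r)%N -> D r`_i) &
     x = \sum_(i < size s) r`_i * s`_i].

Definition ideal_gen D S x : Prop :=
  exists s : seq K, (forall i, (i < size s)%N -> S s`_i) /\ dspan D s x.

Definition principal D I : Prop :=
  exists g, D g /\ forall x, I x <-> exists r, D r /\ x = r * g.

Definition noetherian D : Prop :=
  forall I, is_ideal D I ->
    exists s : seq K, (forall i, (i < size s)%N -> I s`_i) /\
                      forall x, I x <-> dspan D s x.

Definition is_prime_ideal D I : Prop :=
  [/\ is_ideal D I, ~ I 1 & forall x y, D x -> D y -> I (x * y) -> I x \/ I y].

Definition quasi_local D : Prop := is_ideal D (nonunitD D).

Definition not_field D : Prop := exists x, x != 0 /\ nonunitD D x.

(* Krull dimension one (for a quasi-local domain): not a field, and every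
   nonzero prime ideal is the maximal ideal *)
Definition one_dimensional D : Prop :=
  not_field D /\
  forall P, is_prime_ideal D P -> (exists x, x != 0 /\ P x) ->
    forall x, P x <-> nonunitD D x.

Definition intcl D x : Prop :=
  exists p : {poly K}, [/\ p \is monic, (forall i, D p`_i) & root p x].

Definition fin_gen_module D (E : K -> Prop) : Prop :=
  exists s : seq K, forall x, E x <-> dspan D s x.

Definition AV_domain D : Prop :=
  forall a b, D a -> D b -> a != 0 -> b != 0 ->
    exists n, (0 < n)%N /\ (dvdD D (a ^+ n) (b ^+ n) \/ dvdD D (b ^+ n) (a ^+ n)).

Definition API_domain D : Prop :=
  forall S, (forall x, S x -> D x /\ x != 0) -> (exists x, S x) ->
    exists n, (0 < n)%N /\
      principal D (ideal_gen D (fun y => exists d, S d /\ y = d ^+ n)).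

Definition DVR D : Prop :=
  [/\ quasi_local D, not_field D & forall I, is_ideal D I -> principal D I].

Definition root_ext D (E : K -> Prop) : Prop :=
  forall x, E x -> exists n, (0 < n)%N /\ D (x ^+ n).
Definition bounded_root_ext D (E : K -> Prop) : Prop :=
  exists n, (0 < n)%N /\ forall x, E x -> D (x ^+ n).

(* residue field extension D/M ⊆ Dbar/Mbar, with M = nonunits of D and
   Mbar = nonunits of Dbar = intcl D: root extension unfolded *)
Definition residue_root_ext D : Prop :=
  forall x, intcl D x -> exists n, (0 < n)%N /\
     exists d, D d /\ nonunitD (intcl D) (x ^+ n - d).
Definition residue_bounded_root_ext D : Prop :=
  exists n, (0 < n)%N /\ forall x, intcl D x ->
     exists d, D d /\ nonunitD (intcl D) (x ^+ n - d).

(* phi : K^* -> G induces an isomorphism G(D) = K^*/U(D) ~= G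
   (surjective group homomorphism from K^* with kernel U(D)) *)
Definition divgroup_iso D (G : zmodType) (phi : K -> G) : Prop :=
  [/\ (forall x y, x != 0 -> y != 0 -> phi (x * y) = phi x + phi y),
      (forall g, exists x, x != 0 /\ phi x = g) &
      (forall x, x != 0 -> (phi x = 0 <-> unitD D x))].

Definition divgroup_Z D : Prop := exists phi : K -> int, divgroup_iso D phi.

Definition torsion_group (T : zmodType) : Prop :=
  forall t : T, exists n, (0 < n)%N /\ t *+ n = 0.
Definition bounded_order_group (T : zmodType) : Prop :=
  exists n, (0 < n)%N /\ forall t : T, t *+ n = 0.

Definition divgroup_torsion_Z D : Prop :=
  exists (T : zmodType) (phi : K -> (T * int)%type),
    torsion_group T /\ divgroup_iso D phi.
Definition divgroup_bounded_Z D : Prop :=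
  exists (T : zmodType) (phi : K -> (T * int)%type),
    bounded_order_group T /\ divgroup_iso D phi.

End Defs.

(* Main.v *)
(* Let V be the integral closure and t a uniformizer of V: V is a DVR because its
   maximal ideal is a colon ideal, hence principal, and t^k V lies in D for
   some k. Over a prime p in the maximal ideal, x = d mod t gives
   x^(p^i) = d^(p^i) mod t^(i+1), so powers in the residue field lift to powers
   in D; and K^*/U(D) is U(V)/U(D) times the value group of V.
   If the residue characteristic is zero and V is a root extension of D, then
   for each x in V, expanding (1 + 4 z)^m in D for z = x^i shows
   Z_(2)[x] = (D meet Z_(2)[x]) + 2 Z_(2)[x]; by Nakayama (1 + 2 e) x is in D
   for some 1 + 2 e in D with e in Z_(2)[x]. Either x or 1/x has 1 + 2 e a
   unit, so V = D. *)
Require Import Defs.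
From HB Require Import structures.
From mathcomp Require Import all_boot all_order all_algebra.
From mathcomp Require Import fingroup perm boolp ring zify.
Import Order.TTheory GRing.Theory Num.Theory.
Local Open Scope ring_scope.
Set Implicit Arguments. Unset Strict Implicit. Unset Printing Implicit Defensive.

(** * Subrings, spans and integral elements *)

(** The condition on G(D) speaks of abstract groups, so it brings neither an order nor a valuation.
    To return from it to D, the class of one fixed nonzero nonunit of D orients the summand Z and
    serves as a yardstick for powers of other elements. The API condition is exploited on an
    infinite set, c U(V) with c nonzero and c V inside D, where a single exponent has to serve every
    unit of V. In residue characteristic zero the lifting of powers breaks down: positive integers
    are units, so passing to powers of congruent elements gains no factor t. The argument there
    plays two rings against each other. In D one may divide by 4m, while in Z_(2)[x] the element 2
    still counts as small; this is what gives Nakayama's lemma something to act on. The prime 2 is a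
    choice, as all primes are units of D. *)

Definition subring_pred (K : fieldType) (D : K -> Prop) (_ : subring D) :
  {pred K} := fun x => `[< D x >].

Lemma subring_predP (K : fieldType) (D : K -> Prop) (hD : subring D) x :
  (x \in subring_pred hD) <-> D x.
Proof. by split=> [/asboolP|Dx]; [|apply/asboolP]. Qed.

Lemma subring_pred_closed (K : fieldType) (D : K -> Prop) (hD : subring D) :
  subring_closed (subring_pred hD).
Proof.
by case: (hD) => D1 DB DM; split=> [|x y /asboolP ? /asboolP ?|x y /asboolP ? /asboolP ?];
  apply/asboolP; [|apply: DB|apply: DM].
Qed.

(** The proof [hD] is carried in [subring_pred hD] so that the closure structure can be inferred;
    the [rpred] lemmas and [polyOver] then apply to D. *)
HB.instance Definition _ (K : fieldType) (D : K -> Prop) (hD : subring D) :=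
  GRing.isSubringClosed.Build K (subring_pred hD) (subring_pred_closed hD).

Section Subring.
Variables (K : fieldType) (D : K -> Prop).
Hypothesis hD : subring D.
Implicit Types x y : K.

Let DE := subring_predP hD.

Lemma sub1 : D 1. Proof. by case: hD. Qed.
Lemma subB x y : D x -> D y -> D (x - y). Proof. by case: hD => _ + _; apply. Qed.
Lemma subM x y : D x -> D y -> D (x * y). Proof. by case: hD => _ _; apply. Qed.
Lemma sub0 : D 0. Proof. by apply/DE; exact: rpred0. Qed.
Lemma subN x : D x -> D (- x).
Proof. by move/DE=> Dx; apply/DE; rewrite rpredN. Qed.
Lemma subD x y : D x -> D y -> D (x + y).
Proof. by move=> /DE Dx /DE Dy; apply/DE; exact: rpredD. Qed.
Lemma subX x n : D x -> D (x ^+ n).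
Proof. by move=> /DE Dx; apply/DE; exact: rpredX. Qed.
Lemma subMn x n : D x -> D (x *+ n).
Proof. by move=> /DE Dx; apply/DE; exact: rpredMn. Qed.
Lemma subnat n : D n%:R. Proof. exact/subMn/sub1. Qed.
Lemma sub_sum I (r : seq I) (P : pred I) (F : I -> K) :
  (forall i, P i -> D (F i)) -> D (\sum_(i <- r | P i) F i).
Proof.
by move=> DF; apply: big_ind; [exact: sub0|exact: subD|].
Qed.
Lemma sub_horner (p : {poly K}) x : (forall i, D p`_i) -> D x -> D p.[x].
Proof.
move=> Dp Dx; rewrite horner_coef; apply: sub_sum => i _.
exact/subM/subX.
Qed.
Lemma sub_det n (A : 'M[K]_n) : (forall i j, D (A i j)) -> D (\det A).
Proof.
move=> DA; apply/DE; rewrite rpred_sum // => s _; rewrite rpredM ?rpred_sign //.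
by rewrite rpred_prod // => i _; apply/DE.
Qed.
Lemma sub_char_poly n (A : 'M[K]_n) i :
  (forall i j, D (A i j)) -> D (char_poly A)`_i.
Proof.
move=> DA; apply/DE; apply/polyOverP.
rewrite rpred_sum // => s _; rewrite rpredM ?rpred_sign //.
rewrite rpred_prod // => j _; rewrite !mxE rpredB ?rpredMn ?polyOverX //.
by rewrite polyOverC; apply/DE.
Qed.

Lemma unitD1 : unitD D 1.
Proof. by split; rewrite ?invr1 ?oner_neq0 //; exact: sub1. Qed.
Lemma unitDM x y : unitD D x -> unitD D y -> unitD D (x * y).
Proof.
by case=> ? ? ? [? ? ?]; split; rewrite ?invfM ?mulf_neq0 //; exact: subM.
Qed.
Lemma unitDV x : unitD D x -> unitD D x^-1.
Proof. by case=> ? ? ?; split; rewrite ?invr_eq0 ?invrK. Qed.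
Lemma unitDX x n : unitD D x -> unitD D (x ^+ n).
Proof.
by case=> ? ? ?; split; rewrite -?exprVn ?expf_neq0 //; exact: subX.
Qed.
Lemma unitD_mulr x y : D x -> D y -> unitD D (x * y) -> unitD D x.
Proof.
move=> Dx Dy [_]; rewrite mulf_eq0 negb_or => /andP[x0 y0] Dxy; split=> //.
by rewrite -(mulfK y0 x^-1) mulrAC -invfM mulrC; exact: subM.
Qed.
Lemma nonunitD0 : nonunitD D 0.
Proof. by split; [exact: sub0|case; rewrite eqxx]. Qed.
Lemma unitD_add x y : quasi_local D -> unitD D x -> nonunitD D y -> unitD D (x + y).
Proof.
move=> [_ _ addI mulI] ux ny; case: (ny) => Dy _; case: (ux) => Dx _ _.
apply: contrapT => nxy; have: nonunitD D ((x + y) + (-1) * y).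
  apply: addI; first by split=> //; exact: subD.
  by apply: mulI => //; apply/subN/sub1.
by rewrite mulN1r addrK => -[].
Qed.

(** * Finite spans over D and the determinant trick *)

Lemma dspanP s x : dspan D s x <-> exists r : nat -> K,
  (forall i, D (r i)) /\ x = \sum_(i < size s) r i * s`_i.
Proof.
split=> [[r [sr Dr ->]]|[r [Dr ->]]].
  exists (fun i => r`_i); split=> // i.
  by case: (ltnP i (size r)) => [/Dr//|?]; rewrite nth_default //; exact: sub0.
exists (mkseq r (size s)); rewrite size_mkseq; split=> // [i ir|].
  by rewrite nth_mkseq.
by apply: eq_bigr => i _; rewrite nth_mkseq.
Qed.

Lemma dspan0 s : dspan D s 0.
Proof.
apply/dspanP; exists (fun=> 0); split=> [_|]; first exact: sub0.
by rewrite big1 // => i _; rewrite mul0r.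
Qed.

Lemma dspan_add s x y : dspan D s x -> dspan D s y -> dspan D s (x + y).
Proof.
move=> /dspanP[r [Dr ->]] /dspanP[t [Dt ->]]; apply/dspanP.
exists (fun i => r i + t i); split=> [i|]; first exact: subD.
by rewrite -big_split; apply: eq_bigr => i _; rewrite mulrDl.
Qed.

Lemma dspan_scale s a x : D a -> dspan D s x -> dspan D s (a * x).
Proof.
move=> Da /dspanP[r [Dr ->]]; apply/dspanP.
exists (fun i => a * r i); split=> [i|]; first exact: subM.
by rewrite mulr_sumr; apply: eq_bigr => i _; rewrite mulrA.
Qed.

Lemma mem_dspan s x : x \in s -> dspan D s x.
Proof.
case/(nthP 0) => i si <-; apply/dspanP; exists (fun j => (j == i)%:R).
split=> [j|]; first exact: subnat.
rewrite (bigD1 (Ordinal si)) //= eqxx mul1r big1 ?addr0 // => j.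
by rewrite -val_eqE /= => /negPf->; rewrite mul0r.
Qed.

(** Serves as the induction principle for membership in a span. *)
Lemma dspan_min (N : K -> Prop) s :
  N 0 -> (forall x y, N x -> N y -> N (x + y)) ->
  (forall a x, D a -> N x -> N (a * x)) -> (forall x, x \in s -> N x) ->
  forall x, dspan D s x -> N x.
Proof.
move=> N0 NA NZ Ns x /dspanP[r [Dr ->]].
by apply: big_ind => // i _; apply: NZ => //; apply/Ns/mem_nth.
Qed.

Lemma dspan_sub s r x : {subset s <= r} -> dspan D s x -> dspan D r x.
Proof.
move=> sr; apply: dspan_min; [exact: dspan0|exact: dspan_add| |].
  by move=> *; exact: dspan_scale.
by move=> z /sr; exact: mem_dspan.
Qed.

Lemma dspan_sum s I (r : seq I) (P : pred I) (F : I -> K) :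
  (forall i, P i -> dspan D s (F i)) -> dspan D s (\sum_(i <- r | P i) F i).
Proof.
by move=> DF; apply: big_ind; [exact: dspan0|exact: dspan_add|].
Qed.

(* Cayley-Hamilton: x is an eigenvalue of a matrix with entries in D. *)
Lemma intcl_of_dspan s x y : y != 0 -> dspan D s y ->
  (forall z, z \in s -> dspan D s (x * z)) -> intcl D x.
Proof.
move=> y0 /dspanP[ry [Dry yE]] xs.
have /choice[r rP] : forall i : 'I_(size s), exists r : nat -> K,
    (forall j, D (r j)) /\ x * s`_i = \sum_(j < size s) r j * s`_j.
  by move=> i; apply/dspanP/xs/mem_nth.
(* The coefficients are transposed because eigenvectors are rows here: the row of generators is one
   for x, and it is nonzero because the span contains y. *)
pose A := \matrix_(j < size s, i < size s) r i j.
exists (char_poly A); split; first exact: char_poly_monic.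
  by move=> i; apply: sub_char_poly => j k; rewrite mxE; case: (rP k).
rewrite -eigenvalue_root_char; apply/eigenvalueP.
exists (\row_i s`_i).
  apply/rowP => i; rewrite !mxE; case: (rP i) => _ ->.
  by apply: eq_bigr => j _; rewrite !mxE mulrC.
apply: contraNneq y0 => /rowP v0; rewrite yE big1 // => i _.
by have := v0 i; rewrite !mxE => ->; rewrite mulr0.
Qed.

(** * Integral elements *)

Lemma sub_intcl x : D x -> intcl D x.
Proof.
move=> Dx; exists ('X - x%:P); split; rewrite ?monicXsubC ?root_XsubC //.
move=> i; apply/DE; move: i; apply/polyOverP.
by rewrite polyOverXsubC; apply/DE.
Qed.

Lemma intcl_expr x : intcl D x -> exists n (c : nat -> K),
  [/\ (0 < n)%N, forall i, D (c i) & x ^+ n = \sum_(i < n) c i * x ^+ i].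
Proof.
case=> p [pm Dp px].
have [n sp] : exists n, size p = n.+2.
  have := root_size_gt1 (monic_neq0 pm) px; exists (size p).-2; lia.
exists n.+1, (fun i => - p`_i); split=> // [i|]; first exact: subN.
move/rootP: px; rewrite horner_coef sp big_ord_recr /=.
move: (monicP pm); rewrite /lead_coef sp /= => ->; rewrite mul1r => /eqP.
rewrite addrC addr_eq0 => /eqP ->; rewrite -sumrN.
by apply: eq_bigr => i _; rewrite mulNr.
Qed.

(** The monomials [x ^+ i * y ^+ j] below the two degrees span such a module: when a product leaves
    this range, the monic relation of x or of y brings the exponent down again. *)
Lemma intcl_module x y : intcl D x -> intcl D y ->
  exists s, [/\ dspan D s 1, (forall z, dspan D s z -> dspan D s (x * z))
    & (forall z, dspan D s z -> dspan D s (y * z))].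
Proof.
move=> /intcl_expr[n [c [n0 Dc xn]]] /intcl_expr[m [d [m0 Dd ym]]].
pose s := [seq x ^+ i * y ^+ j | i <- iota 0 n, j <- iota 0 m].
have ms i j : (i < n)%N -> (j < m)%N -> dspan D s (x ^+ i * y ^+ j).
  move=> i_n jm; apply: mem_dspan; apply/allpairsP; exists (i, j).
  by rewrite !mem_iota /= !add0n.
have stable a : (forall i j, (i < n)%N -> (j < m)%N ->
    dspan D s (a * (x ^+ i * y ^+ j))) -> forall z, dspan D s z -> dspan D s (a * z).
  move=> H; apply: dspan_min => [|u v Hu Hv|u v Du Hv|u].
  - by rewrite mulr0; exact: dspan0.
  - by rewrite mulrDr; exact: dspan_add.
  - by rewrite mulrCA; exact: dspan_scale.
  - case/allpairsP=> -[i j]; rewrite !mem_iota /= !add0n => -[i_n jm ->].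
    exact: H.
exists s; split.
- by have := ms 0%N 0%N n0 m0; rewrite !expr0 mulr1.
- apply: stable => i j i_n jm; rewrite mulrA -exprS.
  have [i1n|] := ltnP i.+1 n; first exact: ms.
  move=> ni; have -> : i.+1 = n by lia.
  rewrite xn mulr_suml; apply: dspan_sum => k _; rewrite -mulrA.
  by apply: dspan_scale => //; exact: ms.
- apply: stable => i j i_n jm; rewrite mulrCA -exprS.
  have [i1n|] := ltnP j.+1 m; first exact: ms.
  move=> ni; have -> : j.+1 = m by lia.
  rewrite ym mulr_sumr; apply: dspan_sum => k _; rewrite mulrCA.
  by apply: dspan_scale => //; exact: ms.
Qed.

Lemma subring_intcl : subring (intcl D).
Proof.
split; first exact/sub_intcl/sub1.
- move=> x y ix iy; have [s [s1 sx sy]] := intcl_module ix iy.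
  apply: (intcl_of_dspan (oner_neq0 _) s1) => z /mem_dspan sz.
  rewrite mulrBl -mulN1r; apply: dspan_add; first exact: sx.
  by apply: dspan_scale; [exact/subN/sub1|exact: sy].
- move=> x y ix iy; have [s [s1 sx sy]] := intcl_module ix iy.
  apply: (intcl_of_dspan (oner_neq0 _) s1) => z /mem_dspan sz.
  by rewrite -mulrA; exact/sx/sy.
Qed.

(** Multiplying an integral equation of [x^-1] of degree n + 1 by [x ^+ n] leaves [x^-1] alone on
    one side and a polynomial in x over D on the other. *)
Lemma intcl_inv x : D x -> x != 0 -> intcl D x^-1 -> D x^-1.
Proof.
move=> Dx x0 /intcl_expr[[|n] [c [// _ Dc xn]]].
have -> : x^-1 = x ^+ n * x^-1 ^+ n.+1.
  by rewrite exprS mulrCA -exprMn mulfV // expr1n mulr1.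
rewrite xn mulr_sumr; apply: sub_sum => -[i /= i_n] _; rewrite mulrCA.
apply: subM => //; rewrite exprVn -(subnK (ltnSE i_n)) exprD mulfK ?expf_neq0 //.
exact: subX.
Qed.

Lemma unitD_intcl x : D x -> unitD (intcl D) x <-> unitD D x.
Proof.
move=> Dx; split=> -[? ? ?]; split=> //; first exact: intcl_inv.
all: exact: sub_intcl.
Qed.

Lemma nonunitD_intcl x : D x -> nonunitD (intcl D) x <-> nonunitD D x.
Proof.
move=> Dx; split=> -[? u]; split=> //; first by move/(unitD_intcl Dx).
- exact: sub_intcl.
- by move/(unitD_intcl Dx).
Qed.

Lemma common_denom (s : seq K) : is_frac_field D ->
  exists c, [/\ D c, c != 0 & forall x, x \in s -> D (c * x)].
Proof.
move=> hfrac; elim: s => [|x s [c [Dc c0 cs]]].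
  by exists 1; split=> //; [exact: sub1|exact: oner_neq0].
have [a [b [Da Db b0 ->]]] := hfrac x; exists (b * c); split.
- exact: subM.
- by rewrite mulf_neq0.
- move=> z; rewrite inE => /orP[/eqP->|zs].
    have -> : b * c * (a / b) = c * a by field.
    exact: subM.
  by rewrite -mulrA; apply: subM => //; exact: cs.
Qed.

Lemma conductor E : is_frac_field D -> fin_gen_module D E ->
  exists c, [/\ D c, c != 0 & forall x, E x -> D (c * x)].
Proof.
move=> hfrac [s Es]; have [c [Dc c0 cs]] := common_denom s hfrac.
exists c; split=> // x /Es; apply: (dspan_min (N := fun x => D (c * x))) => //.
- by rewrite mulr0; exact: sub0.
- by move=> u v; rewrite mulrDr; exact: subD.
- by move=> u v Du; rewrite mulrCA; exact: subM.
Qed.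

(** * Chains and maximal members in Noetherian rings *)

Lemma noetherianP : noetherian D <-> forall I, is_ideal D I ->
  exists s : seq K, (forall z, z \in s -> I z) /\ forall x, I x -> dspan D s x.
Proof.
have nthE (I : K -> Prop) s :
    (forall i, (i < size s)%N -> I s`_i) <-> forall z, z \in s -> I z.
  split=> [H z /(nthP 0)[i si <-]|H i si]; first exact: H.
  exact/H/mem_nth.
split=> H I hI; have [s [sI Is]] := H I hI; exists s.
  by split=> [|x]; [exact/nthE|move/Is].
split=> [|x]; first exact/nthE.
split; first exact: Is.
by case: hI => _ I0 IA IZ; apply: dspan_min.
Qed.

Lemma chain_stabilizes (C : nat -> K -> Prop) : noetherian D ->
  (forall n, is_ideal D (C n)) -> (forall n x, C n x -> C n.+1 x) ->
  exists N, forall n x, C n x -> C N x.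
Proof.
move=> /noetherianP hN idC incr.
have mono m n x : (m <= n)%N -> C m x -> C n x.
  by move/subnK<-; elim: (n - m)%N => // k IH /IH /incr.
have [|s [Cs sC]] := hN (fun x => exists n, C n x).
  split=> [x [n]||x y [m Cm] [n Cn]|a x Da [n Cn]].
  - by case: (idC n) => + _ _ _; apply.
  - by exists 0%N; case: (idC 0%N).
  - exists (maxn m n); case: (idC (maxn m n)) => _ _ + _; apply.
      exact: mono (leq_maxl _ _) Cm.
    exact: mono (leq_maxr _ _) Cn.
  - by exists n; case: (idC n) => _ _ _; apply.
have [N NP] : exists N, forall z, z \in s -> C N z.
  elim: s Cs {sC} => [|y s IH] Cs; first by exists 0%N.
  have [z zs|N NP] := IH; first by apply: Cs; rewrite inE zs orbT.
  have [M CM] := Cs y (mem_head _ _); exists (maxn M N) => z.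
  rewrite inE => /orP[/eqP->|/NP]; [exact: mono (leq_maxl _ _) CM|].
  exact/mono/leq_maxr.
exists N => n x Cx; have : dspan D s x by apply: sC; exists n.
by case: (idC N) => _ C0 CA CZ; apply: dspan_min.
Qed.

(** Without a maximal member, choice provides a strictly enlarging map f on the family, and its
    iterates from [I0] form a chain that never stabilizes. *)
Lemma maximal_ideal_of (F : (K -> Prop) -> Prop) I0 : noetherian D ->
  (forall I, F I -> is_ideal D I) -> F I0 ->
  exists I, F I /\ forall J, F J -> (forall x, I x -> J x) -> forall x, J x -> I x.
Proof.
move=> hN idF F0; apply: contrapT => /forallNP nomax.
have /choice[f fP] (I : {I | F I}) : exists J : {I | F I},
    (forall x, sval I x -> sval J x) /\ exists x, sval J x /\ ~ sval I x.
  case: I => I FI /=; apply: contrapT => /forallNP noJ.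
  apply: (nomax I); split=> // J FJ IJ x Jx; apply: contrapT => Ix.
  by apply: (noJ (exist _ J FJ)); split=> //=; exists x.
have [||N NP] := @chain_stabilizes (fun n => sval (iter n f (exist _ I0 F0))) hN.
- by move=> n; apply: idF; case: (iter _ _ _).
- by move=> n x /=; case: (fP (iter n f (exist _ I0 F0))) => + _; apply.
case: (fP (iter N f (exist _ I0 F0))) => _ [x [+ nx]].
by move/(NP N.+1).
Qed.

End Subring.

(** * Uniformizers and DVRs *)

Definition uniformizer (K : fieldType) (V : K -> Prop) (t : K) : Prop :=
  t != 0 /\ forall x, nonunitD V x <-> exists r, V r /\ x = r * t.

Section Uniformizer.
Variables (K : fieldType) (V : K -> Prop) (t : K).
Hypotheses (hV : subring V) (hF : is_frac_field V) (hN : noetherian V).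
Hypothesis ht : uniformizer V t.
Implicit Types (x u : K) (z : int).

Let t0 : t != 0. Proof. by case: ht. Qed.
Let nut : nonunitD V t.
Proof. by apply/(proj2 ht); exists 1; rewrite mul1r; split=> //; exact: sub1. Qed.

(** Otherwise every power of t divides x, and the ideals generated by the quotients [x / t ^+ n]
    ascend. Where they stabilize, cancelling x puts [t^-1] into V, although t is a nonunit. *)
Lemma uniformizer_nat x : V x -> x != 0 ->
  exists n u, unitD V u /\ x = u * t ^+ n.
Proof.
move=> Vx x0; apply: contrapT => nx.
have div n : exists r, V r /\ x = r * t ^+ n.
  elim: n => [|n [r [Vr xr]]]; first by exists x; rewrite expr0 mulr1.
  have : nonunitD V r by split=> // ur; apply: nx; exists n, r.
  by move/(proj2 ht) => [q [Vq rq]]; exists q; split=> //; rewrite xr rq exprS mulrA.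
have tn0 n : t ^+ n != 0 by rewrite expf_neq0.
have [n||N NP] := @chain_stabilizes _ _ hV
    (fun n y => V y /\ exists r, V r /\ y = r * (x / t ^+ n)) hN.
- split=> [y []//||y z [Vy [r [Vr ->]]] [Vz [q [Vq ->]]]|a y Va [Vy [r [Vr yE]]]].
  + split; first exact: sub0.
    by exists 0; rewrite mul0r; split=> //; exact: sub0.
  + have [s [Vs xs]] := div n.
    have xn : V (x / t ^+ n) by rewrite xs mulfK.
    split; first by rewrite -mulrDl; apply: subM => //; exact: subD.
    by exists (r + q); rewrite mulrDl; split=> //; exact: subD.
  + split; first exact: subM.
    by exists (a * r); rewrite yE mulrA; split=> //; exact: subM.
- move=> n y [Vy [r [Vr ->]]]; split.
    have [s [Vs xs]] := div n.
    by rewrite xs mulfK //; exact: subM.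
  exists (r * t); split; first by apply: subM => //; case: nut.
  by rewrite exprS; field; rewrite t0 expf_neq0.
case: (NP N.+1 (x / t ^+ N.+1)) => [|_ [r [Vr xr]]].
  split; last by exists 1; rewrite mul1r; split=> //; exact: sub1.
  by have [s [Vs ->]] := div N.+1; rewrite mulfK.
have tr : r = t^-1.
  apply: (mulIf (x := x / t ^+ N)); first by rewrite mulf_neq0 ?invr_eq0.
  by rewrite -xr exprS; field; rewrite t0 expf_neq0.
by case: nut => Vt; apply; split=> //; rewrite -tr.
Qed.

Lemma uniformizer_int x : x != 0 -> exists z, unitD V (x / t ^ z).
Proof.
have [a [b [Va Vb b0 ->]]] := hF x.
rewrite mulf_eq0 negb_or => /andP[a0 _].
have [n [u [uu au]]] := uniformizer_nat Va a0.
have [m [w [uw bw]]] := uniformizer_nat Vb b0.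
exists (n%:Z - m%:Z); have -> : a / b / t ^ (n%:Z - m%:Z) = u / w.
  case: uw => _ w0 _; rewrite expfzDr // -exprnN -!exprnP au bw.
  by field; rewrite w0 !expf_neq0.
by apply: unitDM => //; exact: unitDV.
Qed.

Lemma unitD_uniformizer_expz z : unitD V (t ^ z) -> z = 0.
Proof.
have pos n : ~ unitD V (t ^+ n.+1).
  rewrite exprS => /(unitD_mulr hV) ut; case: nut => Vt; apply; apply: ut => //.
  exact: subX.
case: z => -[//|n]; first by move/pos.
- by rewrite NegzE -exprnN expr1 => /unitDV; rewrite ?invrK => /(pos 0%N).
- by rewrite NegzE -exprnN => /unitDV; rewrite ?invrK => /pos.
Qed.

(** Describing v by its graph reduces every later evaluation to checking that one quotient is a
    unit. The value at 0 is arbitrary. *)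
Lemma uniformizer_valuation : exists v : K -> int,
  forall x z, x != 0 -> unitD V (x / t ^ z) <-> v x = z.
Proof.
have /choice[v vP] x : exists z, x != 0 -> unitD V (x / t ^ z).
  by have [->|/uniformizer_int[z ?]] := eqVneq x 0; [exists 0|exists z].
exists v => x z x0; split=> [xz|<-]; last exact: vP.
have tz n : t ^ n != 0 by rewrite expfz_neq0.
apply/eqP; rewrite eq_sym -subr_eq0; apply/eqP/unitD_uniformizer_expz.
have -> : t ^ (z - v x) = x / t ^ v x / (x / t ^ z).
  by rewrite expfzDr // -invr_expz; field; rewrite x0 !tz.
by apply: unitDM => //; [exact: vP|exact: unitDV].
Qed.

(** A nonzero ideal is generated by the least power of t that it contains. *)
Lemma uniformizer_DVR : quasi_local V -> DVR V.
Proof.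
move=> hl; split=> //; first by exists t.
move=> I [IV I0 IA IZ]; have [noI|] := pselect (forall x, I x -> x = 0).
  exists 0; split; first exact: sub0.
  move=> x; split=> [/noI->|[r [_ ->]]]; rewrite ?mulr0 //.
  by exists 0; rewrite mul0r; split=> //; exact: sub0.
move=> /existsNP[y /not_implyP[Iy /eqP y0]].
have tI x n u : unitD V u -> x = u * t ^+ n -> I x -> I (t ^+ n).
  case=> _ u0 Vu -> /(IZ _ _ Vu); by rewrite mulKf.
have exP : exists n, `[< I (t ^+ n) >].
  have [n [u [uu yu]]] := uniformizer_nat (IV _ Iy) y0.
  by exists n; apply/asboolP; exact: tI yu Iy.
have [n /asboolP In nmin] := ex_minnP exP.
exists (t ^+ n); split; first exact: IV.
move=> x; split=> [Ix|[r [Vr ->]]]; last exact: IZ.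
have [->|x0] := eqVneq x 0.
  by exists 0; rewrite mul0r; split=> //; exact: sub0.
have [m [u [uu xu]]] := uniformizer_nat (IV _ Ix) x0.
have nm : (n <= m)%N by apply/nmin/asboolP; exact: tI xu Ix.
exists (u * t ^+ (m - n)); rewrite -mulrA -exprD subnK //; split=> //.
by apply: subM => //; [case: uu|apply: subX => //; case: nut].
Qed.

End Uniformizer.

Section DVRTheory.
Variables (K : fieldType) (V : K -> Prop).
Hypotheses (hV : subring V) (hF : is_frac_field V) (hDVR : DVR V).

Lemma DVR_noetherian : noetherian V.
Proof.
apply/noetherianP => // I /(let: And3 _ _ h := hDVR in h) [g [Vg Ig]].
exists [:: g]; split=> [z|x /Ig[r [Vr ->]]].
  by rewrite inE => /eqP->; apply/Ig; exists 1; rewrite mul1r; split=> //; exact: sub1.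
by apply: dspan_scale => //; apply: mem_dspan; rewrite ?inE.
Qed.

Lemma DVR_uniformizer : exists t, uniformizer V t.
Proof.
case: hDVR => hl [x [x0 nux]] /(_ _ hl)[t [Vt tP]]; exists t; split=> //.
by apply: contraNneq x0 => t0; have /tP[r [_ ->]] := nux; rewrite t0 mulr0.
Qed.

Lemma DVR_divgroup_Z : divgroup_Z V.
Proof.
have [t ht] := DVR_uniformizer; have [t0 _] := ht.
have [v vP] := uniformizer_valuation hV hF DVR_noetherian ht.
exists v; split=> [x y x0 y0|z|x x0].
- apply/vP; first by rewrite mulf_neq0.
  rewrite expfzDr // invfM mulrACA.
  by apply: unitDM => //; exact/vP.
- exists (t ^ z); have tz : t ^ z != 0 by rewrite expfz_neq0.
  by split=> //; apply/vP => //; rewrite divff //; exact: unitD1.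
- by rewrite -vP // expr0z invr1 mulr1.
Qed.

Lemma DVR_API : API_domain V.
Proof.
move=> S SV [x0 Sx0]; exists 1%N; split=> //; case: hDVR => _ _; apply.
split=> [x [s [sS sx]]||x y [s [sS sx]] [r [rS rx]]|a x Va [s [sS sx]]].
- move: sx; apply: dspan_min => //; [exact: sub0|exact: subD|exact: subM|].
  move=> z /(nthP 0)[i si <-]; have [d [Sd ->]] := sS _ si.
  by rewrite expr1; case: (SV _ Sd).
- by exists [::]; split=> //; exact: dspan0.
- exists (s ++ r); split=> [i|].
    rewrite size_cat nth_cat => ri; case: ltnP => si; first exact: sS.
    by apply: rS; rewrite ltn_subLR.
  apply: dspan_add => //; [move: sx|move: rx]; apply: dspan_sub => // z zs;
    by rewrite mem_cat zs ?orbT.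
- by exists s; split=> //; exact: dspan_scale.
Qed.

End DVRTheory.

(** In a local ring some member of a generating set already generates a principal ideal: if all the
    quotients by a generator h were nonunits, so would be their combination [h / h]. *)
Lemma principal_ideal_gen (K : fieldType) (D S : K -> Prop) (x0 : K) :
  subring D -> quasi_local D -> principal D (ideal_gen D S) ->
  S x0 -> x0 != 0 ->
  exists g, S g /\ forall y, S y -> exists r, D r /\ y = r * g.
Proof.
move=> hD hl [h [Dh hP]] Sx0 x00.
have Sh y : S y -> exists r, D r /\ y = r * h.
  move=> Sy; apply/hP; exists [:: y]; split; first by case.
  by apply: mem_dspan; rewrite ?inE.
have h0 : h != 0.
  by apply: contraNneq x00 => h0; have [r [_ ->]] := Sh _ Sx0; rewrite h0 mulr0.
have [s [sS hs]] : ideal_gen D S h.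
  by apply/hP; exists 1; rewrite mul1r; split=> //; exact: sub1.
have [[z [zs [q [uq zq]]]]|nu] :=
    pselect (exists z, z \in s /\ exists q, unitD D q /\ z = q * h).
  have [Dq q0 Dqi] := uq; exists z; split.
    by move/(nthP 0): zs => [i si <-]; exact: sS.
  move=> y /Sh[r [Dr ->]]; exists (r / q); split; first exact: subM.
  by rewrite zq; field.
have [hl0 hl1 hlA hlZ] := hl.
suff : nonunitD D (h / h) by rewrite divff // => -[_]; case; exact: unitD1.
move: hs; apply: (dspan_min hD (N := fun y => nonunitD D (y / h))) => //.
- by rewrite mul0r.
- by move=> x y nx ny; rewrite mulrDl; exact: hlA.
- by move=> a x Da nx; rewrite -mulrA; exact: hlZ.
- move=> z zs; have [q [Dq zq]] : exists q, D q /\ z = q * h.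
    by apply: Sh; move/(nthP 0): zs => [i si <-]; exact: sS.
  rewrite zq mulfK //; split=> // uq; apply: nu; exists z; split=> //.
  by exists q.
Qed.

Lemma principal_ideal_gen_mem (K : fieldType) (D S : K -> Prop) (g : K) :
  subring D -> D g -> S g -> (forall y, S y -> exists r, D r /\ y = r * g) ->
  principal D (ideal_gen D S).
Proof.
move=> hD Dg Sg gP; exists g; split=> // x; split=> [[s [sS sx]]|[r [Dr ->]]].
  move: sx; apply: (dspan_min hD (N := fun x => exists r, D r /\ x = r * g)) => //.
  - by exists 0; rewrite mul0r; split=> //; exact: sub0.
  - move=> _ _ [r [Dr ->]] [q [Dq ->]]; exists (r + q); rewrite mulrDl; split=> //.
    exact: subD.
  - move=> a _ Da [r [Dr ->]]; exists (a * r); rewrite mulrA; split=> //.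
    exact: subM.
  - by move=> z /(nthP 0)[i si <-]; exact/gP/sS.
exists [:: g]; split; first by case.
by apply: dspan_scale => //; apply: mem_dspan; rewrite ?inE.
Qed.

(** The set with members a and b suffices, because a principal ideal generated by [a ^+ n] and
    [b ^+ n] is generated by one of the two. *)
Lemma API_AV (K : fieldType) (D : K -> Prop) :
  subring D -> quasi_local D -> API_domain D -> AV_domain D.
Proof.
move=> hD hl hAPI a b Da Db a0 b0.
have [x [->//|->//]||n [n0 hp]] := hAPI (fun x => x = a \/ x = b).
  by exists a; left.
exists n; split=> //.
have [||_ [[d [[->|->] ->]] gP]] := principal_ideal_gen (x0 := a ^+ n) hD hl hp.
- by exists a; split=> //; left.
- by rewrite expf_neq0.
- by left; apply: gP; exists b; split=> //; right.
- by right; apply: gP; exists a; split=> //; left.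
Qed.

(** * The integral closure is a DVR *)

(** Multiplication by c carries an ideal of E to an ideal of D, whose generators are then divided by
    c. The span is over D itself, as the determinant trick for integrality over D requires. *)
Lemma ideal_denom_dspan (K : fieldType) (D E I : K -> Prop) c :
  subring D -> noetherian D -> (forall x, D x -> E x) -> c != 0 ->
  (forall x, E x -> D (c * x)) -> is_ideal E I ->
  exists s : seq K, (forall z, z \in s -> I z) /\ forall x, I x -> dspan D s x.
Proof.
move=> hD /(noetherianP hD) hN DE c0 cE [IE I0 IA IZ].
have [|s [sI Is]] := hN (fun y => exists x, I x /\ y = c * x).
  split=> [_ [x [Ix ->]]||_ _ [x [Ix ->]] [y [Iy ->]]|a _ Da [x [Ix ->]]].
  - exact/cE/IE.
  - by exists 0; rewrite mulr0.
  - by exists (x + y); rewrite mulrDr; split=> //; exact: IA.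
  - by exists (a * x); rewrite mulrCA; split=> //; apply: IZ => //; exact: DE.
exists [seq y / c | y <- s]; split=> [_ /mapP[y /sI[x [Ix ->]] ->]|x Ix].
  by rewrite mulrAC divff // mul1r.
suff H y : dspan D s y -> dspan D [seq y / c | y <- s] (y / c).
  by rewrite -(mulKf c0 x) mulrC; apply/H/Is; exists x.
move: y; apply: (dspan_min hD (N := fun y => dspan D _ (y / c))) => //.
- by rewrite mul0r; exact: dspan0.
- by move=> y z ny nz; rewrite mulrDl; exact: dspan_add.
- by move=> a y Da ny; rewrite -mulrA; exact: dspan_scale.
- by move=> z zs; apply: mem_dspan => //; exact: map_f.
Qed.

Section IntegralClosure.
Variables (K : fieldType) (D : K -> Prop).
Hypotheses (hD : subring D) (hF : is_frac_field D) (hN : noetherian D).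
Hypotheses (hl : quasi_local D) (hdim : one_dimensional D).
Hypotheses (hbarl : quasi_local (intcl D)) (hfin : fin_gen_module D (intcl D)).

Let V := intcl D.
Let hV : subring V. Proof. exact: subring_intcl. Qed.
Let DV x : D x -> V x. Proof. exact: sub_intcl. Qed.

Lemma intcl_noetherian : noetherian V.
Proof.
have [c [Dc c0 cV]] := conductor hD hF hfin.
apply/(noetherianP hV) => I hI.
have [s [sI Is]] := ideal_denom_dspan hD hN DV c0 cV hI; exists s; split=> // x /Is.
apply: dspan_min => //; first exact: dspan0.
- by move=> ? ?; exact: dspan_add.
- by move=> a y Da; apply: dspan_scale => //; exact: DV.
- by move=> z; exact: mem_dspan.
Qed.

Lemma intcl_frac : is_frac_field V.
Proof.
by move=> x; have [a [b [Da Db b0 ->]]] := hF x; exists a, b; split=> //; exact: DV.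
Qed.

(* Lying over: P contracts to the maximal ideal of D, and if q(x) is in P with
   q over D and x a nonunit outside P, cancelling x repeatedly puts all
   coefficients of q in the maximal ideal; a monic q is impossible. *)
Lemma intcl_prime_maximal P : is_prime_ideal V P -> (exists x, x != 0 /\ P x) ->
  forall x, nonunitD V x -> P x.
Proof.
move=> [hP P1 Pprime] [a [a0 Pa]] x nux; have [PV P0 PA PZ] := hP.
have PD : forall y, P y /\ D y <-> nonunitD D y.
  apply: (proj2 hdim).
    split; last first.
    - by move=> y z Dy Dz [Pyz _]; case: (Pprime y z (DV Dy) (DV Dz) Pyz); [left|right].
    - by case.
    split=> [y []//||y z [Py Dy] [Pz Dz]|r y Dr [Py Dy]].
    - by split=> //; exact: sub0.
    - by split; [exact: PA|exact: subD].
    - by split; [apply: PZ => //; exact: DV|exact: subM].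
  have [c [Dc c0 cV]] := conductor hD hF hfin.
  (* The contraction of P to D is nonzero because the conductor element c moves a into D. *)
  exists (c * a); split; first by rewrite mulf_neq0.
  by split; [apply: PZ => //; exact: DV|exact/cV/PV].
have Pnu y : P y -> nonunitD V y.
  move=> Py; split; first exact: PV.
  by case=> _ y0 Vy; apply: P1; rewrite -(mulVf y0); exact: PZ.
apply: contrapT => nPx; have Vx : V x by case: nux.
suff coefM (q : {poly K}) : (forall i, D q`_i) -> P q.[x] -> forall i, nonunitD D q`_i.
  case: (Vx) => p [pm Dp /rootP px].
  have := coefM p Dp; rewrite px => /(_ P0 (size p).-1).
  by move/monicP: pm; rewrite /lead_coef => -> [_]; apply; exact: unitD1.
elim/poly_ind: q => [_ _ i|q c IH Dqc]; first by rewrite coef0; exact: nonunitD0.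
have Dc : D c by have := Dqc 0%N; rewrite coefD coefMX coefC eqxx add0r.
have Dq i : D q`_i by have := Dqc i.+1; rewrite coefD coefMX coefC addr0.
have Vqx : V q.[x] by apply: sub_horner => // i; exact: DV.
rewrite hornerMXaddC => Pqx.
have nuc : nonunitD D c.
  split=> // /(unitD_intcl hD Dc) uc; have [hl0 hl1 hlA hlZ] := hbarl.
  suff : nonunitD V c by case.
  have -> : c = (q.[x] * x + c) + (- q.[x]) * x by ring.
  by apply: hlA; [exact: Pnu|apply: hlZ => //; exact: subN].
have Pq : P q.[x].
  suff /(Pprime _ _ Vqx Vx)[//|//] : P (q.[x] * x).
  have -> : q.[x] * x = (q.[x] * x + c) + (-1) * c by ring.
  apply: PA => //; apply: PZ; first exact: (subN hV (sub1 hV)).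
  by have [] := proj2 (PD c) nuc.
move=> i; rewrite coefD coefMX coefC; case: i => [|i] /=.
  by rewrite add0r.
by rewrite addr0; exact: IH.
Qed.

(* The conductor of y modulo a, chosen maximal, is prime, hence the maximal
   ideal m; then y/a maps m into V but is not integral, so (y/a)m contains a
   unit and m is principal. *)
Lemma intcl_uniformizer : exists t, uniformizer V t.
Proof.
have [a [a0 nua]] : exists a, a != 0 /\ nonunitD V a.
  case: (proj1 hdim) => a [a0 nua]; exists a; split=> //.
  by apply/(nonunitD_intcl hD) => //; case: nua.
have Va : V a by case: nua.
(* [C y] is the colon ideal of aV by y; it is proper when y is outside aV, and [C 1] is aV. *)
pose C y z := V z /\ exists r, V r /\ z * y = r * a.
have Cid y : is_ideal V (C y).
  split=> [z []//||z w [Vz [r [Vr zr]]] [Vw [q [Vq wq]]]|b z Vb [Vz [r [Vr zr]]]].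
  - by split; [exact: sub0|exists 0; rewrite !mul0r; split=> //; exact: sub0].
  - split; first exact: subD.
    by exists (r + q); rewrite !mulrDl zr wq; split=> //; exact: subD.
  - split; first exact: subM.
    by exists (b * r); rewrite -!mulrA zr; split=> //; exact: subM.
have [||I [[y [Vy ny IE]] Imax]] := maximal_ideal_of (I0 := C 1) hV
    (F := fun I => exists y, [/\ V y, ~ (exists r, V r /\ y = r * a) & I = C y])
    intcl_noetherian.
- by move=> I [y [_ _ ->]].
- exists 1; split=> //; first exact: sub1.
  move=> [r [Vr ra]]; case: nua => _; apply; apply: (unitD_mulr hV Va Vr).
  by rewrite mulrC -ra; exact: unitD1.
have Iprime : is_prime_ideal V I.
  rewrite IE; split=> //.
    by case=> _ [r [Vr yr]]; apply: ny; exists r; rewrite -yr mul1r.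
  move=> z w Vz Vw [_ [r [Vr zwr]]].
  have [Cz|nCz] := pselect (C y z); [by left|right].
  (* [C (z * y)] contains [C y] and belongs to the family because z is not in [C y]; maximality then
     pulls w back into [C y]. *)
  rewrite -IE; apply: (Imax (C (z * y))).
  - exists (z * y); split=> //; first exact: subM.
    by move=> [q [Vq zq]]; apply: nCz; split=> //; exists q.
  - rewrite IE => u [Vu [q [Vq uq]]]; split=> //; exists (z * q).
    by rewrite mulrCA uq mulrA; split=> //; exact: subM.
  - by split=> //; exists r; rewrite -zwr; split=> //; ring.
have IM : forall x, nonunitD V x -> C y x.
  rewrite -IE; apply: intcl_prime_maximal => //; exists a; split=> //.
  by rewrite IE; split=> //; exists y; rewrite mulrC.
pose s := y / a.
have sM x : nonunitD V x -> V (s * x).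
  by move/IM => [Vx [r [Vr xr]]]; rewrite /s mulrC mulrA xr mulfK.
have nVs : ~ V s by move=> Vs; apply: ny; exists s; rewrite divfK.
have [/existsNP[t /not_implyP[nut ust]]|smax] :=
    pselect (~ forall x, nonunitD V x -> nonunitD V (s * x)).
  have {}ust : unitD V (s * t) by apply: contrapT => nust; apply: ust; split=> //; exact: sM.
  exists t; split.
    by apply: contraPneq ust => ->; rewrite mulr0 => -[_]; rewrite eqxx.
  move=> x; split=> [nux|[r [Vr ->]]]; last by have [_ _ _] := hbarl; apply.
  exists (s * x / (s * t)); split; first by apply: subM; [|exact: sM|case: ust].
  case: ust => _; rewrite mulf_eq0 negb_or => /andP[s0 t0] _.
  by field; rewrite s0 t0.
(* Here s maps the maximal ideal of V into itself. That ideal is finitely spanned over D, so s is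
   integral over D, against the choice of y. *)
exfalso; apply: nVs; have [c [Dc c0 cV]] := conductor hD hF hfin.
have [r [rM Mr]] := ideal_denom_dspan hD hN DV c0 cV hbarl.
apply: (intcl_of_dspan hD a0 (Mr _ nua)) => z /rM nuz; apply: Mr.
by apply: contrapT => nu; apply: smax => H; exact/nu/H.
Qed.

Lemma conductor_uniformizer t : uniformizer V t ->
  exists k, forall x, V x -> D (t ^+ k * x).
Proof.
move=> ht; have [c [Dc c0 cV]] := conductor hD hF hfin.
have [k [u [[Vu u0 Vui] cu]]] := uniformizer_nat hV intcl_noetherian ht (DV Dc) c0.
exists k => x Vx; have -> : t ^+ k * x = c * (u^-1 * x) by rewrite cu; field.
by apply: cV; exact: (subM hV).
Qed.

(** For x = a/b one divisibility puts [x ^+ n] into D. The other puts its inverse into D, and then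
    [x ^+ n], being integral, is in D as well. *)
Lemma AV_root_ext : AV_domain D -> root_ext D V.
Proof.
move=> hAV x Vx; have [->|x0] := eqVneq x 0.
  by exists 1%N; rewrite expr1; split=> //; exact: sub0.
have [a [b [Da Db b0 xE]]] := hF x.
have a0 : a != 0 by apply: contraNneq x0 => a0; rewrite xE a0 mul0r.
have [n [n0 ab]] := hAV a b Da Db a0 b0; exists n; split=> //.
case: ab => -[c [Dc]] abc.
  have cE : c = (x ^+ n)^-1 by rewrite xE expr_div_n invf_div abc mulfK // expf_neq0.
  rewrite -[x ^+ n]invrK -cE; apply: intcl_inv => //.
    by rewrite cE invr_eq0 expf_neq0.
  by rewrite cE invrK; exact: subX.
by rewrite xE expr_div_n abc mulfK // expf_neq0.
Qed.

(** The ideal generated by the n-th powers of c U(V) has a generator [(c * u0) ^+ n], so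
    [u ^+ n / u0 ^+ n] is in D for every unit u of V. Taking u = 1 removes [u0]. A nonunit is a
    multiple of t, so its power k + 1 already lies in t^k V; the exponent n(k + 1) covers both
    cases. *)
Lemma API_bounded_root_ext : API_domain D -> bounded_root_ext D V.
Proof.
move=> hAPI; have [c [Dc c0 cV]] := conductor hD hF hfin.
have [t ht] := intcl_uniformizer.
have [x [u [[Vu u0 _] ->]]||n [n0 hp]] := hAPI (fun x => exists u, unitD V u /\ x = c * u).
- by split; [exact: cV|rewrite mulf_neq0].
- by exists c, 1; rewrite mulr1; split=> //; exact: unitD1.
have [||_ [[_ [[u0 [uu0 ->]] ->]] gP]] := principal_ideal_gen (x0 := c ^+ n) hD hl hp.
- by exists c; split=> //; exists 1; rewrite mulr1; split=> //; exact: unitD1.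
- by rewrite expf_neq0.
have cn0 : c ^+ n != 0 by rewrite expf_neq0.
have [Vu0 u00 _] := uu0; have un0 : u0 ^+ n != 0 by rewrite expf_neq0.
have uD u : unitD V u -> D (u ^+ n / u0 ^+ n).
  move=> uu; have [|r [Dr]] := gP ((c * u) ^+ n).
    by exists (c * u); split=> //; exists u.
  rewrite !exprMn mulrCA => /(mulfI cn0) ->; by rewrite mulfK.
have Du0 : D (u0 ^+ n).
  have := uD 1 (unitD1 hV); rewrite expr1n mul1r => Di.
  rewrite -[u0 ^+ n]invrK; apply: intcl_inv => //; first by rewrite invr_eq0.
  by rewrite invrK; exact: subX.
have [k kP] := conductor_uniformizer ht.
exists (n * k.+1)%N; split=> [|y Vy]; first by rewrite muln_gt0 n0.
have [uy|nuy] := pselect (unitD V y).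
  rewrite exprM; apply: subX => //; rewrite -(divfK un0 (y ^+ n)).
  by apply: subM => //; exact: uD.
rewrite mulnC exprM; apply: subX => //.
have [r [Vr ->]] : exists r, V r /\ y = r * t by apply/(proj2 ht).
rewrite exprMn [t ^+ _]exprSr mulrCA; apply: kP.
apply: (subM hV); first exact: (subX hV).
by case: (proj2 (proj2 ht t)) => //; exists 1; rewrite mul1r; split=> //; exact: sub1.
Qed.

End IntegralClosure.

(** * Root extensions and the splitting of the group of divisibility *)

(** Builds W/U with carrier a set of representatives: [rep] chooses one member of each coset, and T
    consists of its fixed points. Choice from extensionally equal predicates gives the same value,
    so [rep x] depends on the coset only. *)
Lemma quotient_group (K : fieldType) (U W : K -> Prop) :
  (forall x, U x -> W x) -> (forall x, W x -> x != 0) -> U 1 ->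
  (forall x y, U x -> U y -> U (x * y)) -> (forall x, U x -> U x^-1) ->
  (forall x y, W x -> W y -> W (x * y)) -> (forall x, W x -> W x^-1) ->
  exists (T : zmodType) (psi : K -> T),
    [/\ forall x y, W x -> W y -> psi (x * y) = psi x + psi y,
        forall a, exists x, W x /\ psi x = a
      & forall x, W x -> psi x = 0 <-> U x].
Proof.
move=> UW Wn0 U1 UM UV WM WV; have W1 : W 1 := UW _ U1.
pose cls x : pred K := fun y => `[< W y /\ U (y / x) >].
pose rep x := choose (cls x) x.
have clsx x : W x -> cls x x.
  by move=> Wx; apply/asboolP; rewrite divff ?Wn0.
have repP x : W x -> W (rep x) /\ U (rep x / x).
  by move=> Wx; apply/asboolP/(@chooseP _ (cls x))/clsx.
have rep_eq x y : W x -> W y -> U (x / y) -> rep x = rep y.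
  move=> Wx Wy Uxy; have x0 := Wn0 _ Wx; have y0 := Wn0 _ Wy.
  have cxy : cls x =1 cls y.
    move=> z; apply/asboolP/asboolP=> -[Wz Uz]; split=> //.
      by have -> : z / y = (z / x) * (x / y) by [field; rewrite x0 y0]; exact: UM.
    have -> : z / x = (z / y) * (x / y)^-1 by field; rewrite x0 y0.
    exact/UM/UV.
  rewrite /rep (eq_choose cxy); apply: choose_id; last exact: clsx.
  by rewrite -cxy; exact: clsx.
pose T := {x : K | `[< W x /\ rep x = x >]}.
have repr x : W x -> `[< W (rep x) /\ rep (rep x) = rep x >].
  move=> Wx; have [Wr Ur] := repP x Wx; apply/asboolP; split=> //.
  exact: rep_eq.
(* The class of 1 is the filler value of [insubd]; psi is meant on W only. *)
pose psi x : T := insubd (exist _ (rep 1) (repr 1 W1)) (rep x).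
have psiE x : W x -> sval (psi x) = rep x by move=> Wx; exact/insubdK/repr.
have psiP x y : W x -> W y -> psi x = psi y <-> U (x / y).
  move=> Wx Wy; split=> [xy|Uxy]; last by rewrite /psi (rep_eq x y).
  have [_ Ux] := repP x Wx; have [_ Uy] := repP y Wy.
  have rxy : rep x = rep y by rewrite -!psiE // xy.
  have -> : x / y = (rep x / x)^-1 * (rep y / y).
    rewrite rxy; have r0 : rep y != 0 by apply/Wn0; case: (repP y Wy).
    by field; rewrite r0 !Wn0.
  exact/UM/Uy/UV.
have Wval (a : T) : W (sval a) by case: a => x /= /asboolP[].
have psi_val (a : T) : psi (sval a) = a.
  apply: val_inj; rewrite /= psiE; last exact: Wval.
  by case: a => x /= /asboolP[].
have Uval x : W x -> U (sval (psi x) / x).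
  by move=> Wx; rewrite psiE //; case: (repP x Wx).
pose add (a b : T) := psi (sval a * sval b).
have psiM x y : W x -> W y -> psi (x * y) = add (psi x) (psi y).
  move=> Wx Wy; apply/esym/psiP; [by apply: WM|exact: WM|].
  by rewrite invfM mulrACA; apply: UM; exact: Uval.
have addC : commutative add by move=> a b; rewrite /add mulrC.
have addA : associative add.
  move=> a b c; rewrite -{1}(psi_val a) -{2}(psi_val c).
  by rewrite -!psiM ?mulrA //; exact: WM.
have add0 : left_id (psi 1) add.
  by move=> a; rewrite -{1}(psi_val a) -psiM // mul1r psi_val.
have addN : left_inverse (psi 1) (fun a => psi (sval a)^-1) add.
  by move=> a; rewrite -{2}(psi_val a) -psiM ?mulVf ?Wn0 //; exact: WV.
pose Tz : zmodType := HB.pack T (GRing.isZmodule.Build T addA addC add0 addN).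
exists Tz, psi; split=> // [a|x Wx].
  by exists (sval a); split; [exact: Wval|exact: psi_val].
by rewrite -[x in X in _ <-> X]divr1 -psiP.
Qed.

Section Powers.
Variables (K : fieldType) (D : K -> Prop).
Hypotheses (hD : subring D) (hF : is_frac_field D) (hN : noetherian D).
Hypotheses (hl : quasi_local D) (hdim : one_dimensional D).
Hypotheses (hbarl : quasi_local (intcl D)) (hfin : fin_gen_module D (intcl D)).

Let V := intcl D.
Let hV : subring V. Proof. exact: subring_intcl. Qed.
Let DV x : D x -> V x. Proof. exact: sub_intcl. Qed.

(** In x^p - y^p the cofactor of x - y is congruent to p y^(p-1) modulo t, hence divisible by t, so
    each p-th power gains a factor t. The exponent depends only on p and on the conductor exponent
    k, so it serves plain and bounded root extensions alike. *)
Lemma residue_power p : prime p -> nonunitD D p%:R ->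
  exists N, (0 < N)%N /\ forall x d, V x -> D d -> nonunitD V (x - d) -> D (x ^+ N).
Proof.
move=> pp nup; have [t ht] := intcl_uniformizer hD hF hN hdim hbarl hfin.
have tP := proj2 ht.
have Vt : V t by case: (proj2 (tP t)) => //; exists 1; rewrite mul1r; split=> //; exact: sub1.
have [q [Vq pE]] : exists q, V q /\ p%:R = q * t.
  by apply/tP/nonunitD_intcl => //; exact: subnat.
have congr i x y : V x -> V y -> (exists r, V r /\ x - y = r * t ^+ i.+1) ->
    exists r, V r /\ x ^+ p - y ^+ p = r * t ^+ i.+2.
  move=> Vx Vy [r [Vr xy]].
  suff [s [Vs sE]] : exists s, V s /\ \sum_(j < p) x ^+ (p.-1 - j) * y ^+ j = s * t.
    exists (r * s); split; first exact: (subM hV).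
    by rewrite subrXX xy sE [t ^+ i.+2]exprSr mulrACA.
  have diff j : exists s, V s /\ x ^+ j - y ^+ j = s * t.
    exists (r * t ^+ i * \sum_(k < j) x ^+ (j.-1 - k) * y ^+ k).
    split; last by rewrite subrXX xy exprSr; ring.
    apply: (subM hV); first by apply: (subM hV) => //; exact: (subX hV).
    by apply: sub_sum => // k _; apply: (subM hV); exact: (subX hV).
  have -> : \sum_(j < p) x ^+ (p.-1 - j) * y ^+ j =
      \sum_(j < p) (x ^+ (p.-1 - j) - y ^+ (p.-1 - j)) * y ^+ j + y ^+ p.-1 *+ p.
    have -> : y ^+ p.-1 *+ p = \sum_(j < p) y ^+ p.-1 by rewrite sumr_const card_ord.
    rewrite -big_split; apply: eq_bigr => -[j /= jp] _; rewrite mulrBl -exprD.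
    by rewrite subnK ?subrK //; lia.
  have [s [Vs ->]] : exists s, V s /\
      \sum_(j < p) (x ^+ (p.-1 - j) - y ^+ (p.-1 - j)) * y ^+ j = s * t.
    apply: (big_ind (fun z => exists s, V s /\ z = s * t)) => [|_ _ [u [Vu ->]] [w [Vw ->]]|j _].
    - by exists 0; rewrite mul0r; split=> //; exact: sub0.
    - by exists (u + w); rewrite mulrDl; split=> //; exact: (subD hV).
    - have [s [Vs ->]] := diff (p.-1 - j)%N; exists (s * y ^+ j).
      by rewrite mulrAC; split=> //; apply: (subM hV) => //; exact: (subX hV).
  exists (s + y ^+ p.-1 * q); split.
    by apply: (subD hV) => //; apply: (subM hV) => //; exact: (subX hV).
  by rewrite -[y ^+ _ *+ p]mulr_natr pE mulrDl mulrA.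
have [k kP] := conductor_uniformizer hD hF hN hfin ht.
exists (p ^ k)%N; split=> [|x d Vx Dd nux]; first by rewrite expn_gt0 prime_gt0.
suff [r [Vr xd]] : exists r, V r /\ x ^+ (p ^ k) - d ^+ (p ^ k) = r * t ^+ k.+1.
  rewrite -(subrK (d ^+ (p ^ k)) (x ^+ _)); apply: (subD hD); last exact: (subX hD).
  by rewrite xd exprSr mulrCA; apply: kP; exact: (subM hV).
have Vd := DV Dd.
elim: k {kP} => [|k IH]; first by rewrite expn0 !expr1; apply/tP.
by rewrite expnSr !exprM; apply: congr => //; exact: (subX hV).
Qed.

Lemma root_residue : root_ext D V -> residue_root_ext D.
Proof.
move=> h x Vx; have [n [n0 Dx]] := h x Vx; exists n; split=> //.
by exists (x ^+ n); rewrite subrr; split=> //; exact: nonunitD0.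
Qed.

Lemma bounded_root_residue : bounded_root_ext D V -> residue_bounded_root_ext D.
Proof.
move=> [n [n0 h]]; exists n; split=> // x Vx.
by exists (x ^+ n); rewrite subrr; split; [exact: h|exact: nonunitD0].
Qed.

Lemma residue_root p : prime p -> nonunitD D p%:R ->
  residue_root_ext D -> root_ext D V.
Proof.
move=> pp nup h x Vx; have [N [N0 NP]] := residue_power pp nup.
have [n [n0 [d [Dd nu]]]] := h x Vx; exists (n * N)%N; rewrite muln_gt0 n0 N0.
by split=> //; rewrite exprM; apply: NP Dd nu; exact: (subX hV).
Qed.

Lemma residue_bounded_root p : prime p -> nonunitD D p%:R ->
  residue_bounded_root_ext D -> bounded_root_ext D V.
Proof.
move=> pp nup [n [n0 h]]; have [N [N0 NP]] := residue_power pp nup.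
exists (n * N)%N; rewrite muln_gt0 n0 N0; split=> // x Vx.
have [d [Dd nu]] := h x Vx.
by rewrite exprM; apply: NP Dd nu; exact: (subX hV).
Qed.

(* T = U(V)/U(D); a uniformizer of V splits K^*/U(D) -> K^*/U(V) = Z. *)
Lemma divgroup_splitting : exists (T : zmodType) (phi : K -> (T * int)%type),
  divgroup_iso D phi /\
  forall a n, (exists x, unitD V x /\ phi x = (a, 0)) /\
    (forall x, unitD V x -> phi x = (a, 0) -> D (x ^+ n) -> a *+ n = 0).
Proof.
have [t ht] := intcl_uniformizer hD hF hN hdim hbarl hfin.
have [v vP] := uniformizer_valuation hV (intcl_frac hD hF)
  (intcl_noetherian hD hF hN hfin) ht.
have [t0 _] := ht; have tz0 z : t ^ z != 0 by rewrite expfz_neq0.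
have unit_sub x : unitD D x -> unitD V x by move=> ux; apply/unitD_intcl => //; case: ux.
have [|x [_ //]||x y|x|x y|x|T [psi [psiM psi_surj psi_ker]]] :=
    @quotient_group K (unitD D) (unitD V).
- exact: unit_sub.
- exact: unitD1.
- exact: unitDM.
- exact: unitDV.
- exact: unitDM.
- exact: unitDV.
have psi1 : psi 1 = 0 by apply/psi_ker; exact: unitD1.
have psiX x n : unitD V x -> psi (x ^+ n) = psi x *+ n.
  move=> ux; elim: n => [|n IH]; first by rewrite expr0 mulr0n.
  by rewrite exprS psiM ?IH ?mulrS //; exact: unitDX.
have v_unit x z : unitD V x -> v (x * t ^ z) = z.
  move=> ux; have x0 : x != 0 by case: ux.
  by apply/vP; rewrite ?mulfK // mulf_neq0.
have vM x y : x != 0 -> y != 0 -> v (x * y) = v x + v y.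
  move=> x0 y0; apply/vP; first by rewrite mulf_neq0.
  rewrite expfzDr // invfM mulrACA.
  by apply: (unitDM hV); exact/vP.
have unit_part x : x != 0 -> unitD V (x / t ^ v x) by move=> x0; exact/vP.
have v0 x : unitD V x -> v x = 0.
  by move=> ux; rewrite -(v_unit x 0 ux) expr0z mulr1.
exists T, (fun x => (psi (x / t ^ v x), v x)); split.
  split=> [x y x0 y0|[a z]|x x0].
  - rewrite vM //; congr (_, _); rewrite -psiM; [|exact: unit_part..].
    by rewrite expfzDr // invfM mulrACA.
  - have [x [ux <-]] := psi_surj a; exists (x * t ^ z).
    rewrite v_unit // mulfK // mulf_neq0 //; by case: ux.
  - split=> [[+ vx]|ux].
      rewrite vx expr0z invr1 mulr1 => /psi_ker; apply.
      by move/(vP x 0 x0): vx; rewrite expr0z invr1 mulr1.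
    have uVx := unit_sub _ ux; rewrite v0 // expr0z invr1 mulr1.
    by congr (_, _); apply/psi_ker.
move=> a n; split=> [|x ux [<- _] Dxn].
  have [x [ux <-]] := psi_surj a; exists x; split=> //.
  by rewrite v0 // expr0z invr1 mulr1.
rewrite v0 // expr0z invr1 mulr1 -psiX //; apply/psi_ker; first exact: unitDX.
by apply/(unitD_intcl hD Dxn); exact: unitDX.
Qed.

Lemma root_divgroup : root_ext D V -> divgroup_torsion_Z D.
Proof.
move=> h; have [T [phi [iso tors]]] := divgroup_splitting.
exists T, phi; split=> // a; have [[x [ux xa]] _] := tors a 0%N.
have [n [n0 Dxn]] : exists n, (0 < n)%N /\ D (x ^+ n) by apply: h; case: ux.
by exists n; split=> //; apply: (proj2 (tors a n)) Dxn.
Qed.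

Lemma bounded_root_divgroup : bounded_root_ext D V -> divgroup_bounded_Z D.
Proof.
move=> [n [n0 h]]; have [T [phi [iso tors]]] := divgroup_splitting.
exists T, phi; split=> //; exists n; split=> // a.
have [[x [ux xa]] H] := tors a n; apply: (H x) => //.
by apply: h; case: ux.
Qed.

End Powers.

(** * Valuations from the group of divisibility *)

(** Balances exponents: the power [|k|] of an element with integer component z and the power [|z|]
    of one with component k have equal components when the signs do not oppose. *)
Lemma mulr_norm_sg (R : realDomainType) (k z : R) :
  k != 0 -> 0 <= Num.sg k * z -> z * `|k| = k * `|z|.
Proof.
by case: sgrP => // _ _; rewrite ?mul1r ?mulN1r ?oppr_ge0 => hz;
  rewrite ?(ger0_norm hz) ?(ler0_norm hz) ?mulrN mulrC.
Qed.

Section DivisibilityGroup.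
Variables (K : fieldType) (D : K -> Prop).
Hypotheses (hD : subring D) (hdim : one_dimensional D).

Lemma divgroup_expr (G : zmodType) (phi : K -> G) x n :
  divgroup_iso D phi -> x != 0 -> phi (x ^+ n) = phi x *+ n.
Proof.
move=> [phiM _ phi_ker] x0; elim: n => [|n IH].
  by rewrite expr0 mulr0n; apply/phi_ker; [exact: oner_neq0|exact: unitD1].
by rewrite exprS phiM ?expf_neq0 // IH mulrS.
Qed.

Lemma divgroup_inv (G : zmodType) (phi : K -> G) x :
  divgroup_iso D phi -> x != 0 -> phi x^-1 = - phi x.
Proof.
move=> [phiM _ phi_ker] x0; apply/eqP; rewrite -addr_eq0 -phiM ?invr_eq0 //.
rewrite mulVf //; apply/eqP/phi_ker; [exact: oner_neq0|exact: unitD1].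
Qed.

(* Let m be a nonzero nonunit, with class (s, k) and q s = 0. If the class
   (a, z) of x has n a = 0, then x^(nkq) and m^(qnz) have the same class. *)
Lemma divgroup_sign (T : zmodType) (phi : K -> (T * int)%type) :
  torsion_group T -> divgroup_iso D phi ->
  exists (v : K -> int) N, [/\ (0 < N)%N,
    forall x y, x != 0 -> y != 0 -> v (x / y) = v x - v y,
    forall x, D x -> x != 0 -> 0 <= v x
  & forall x n, x != 0 -> (phi x).1 *+ n = 0 -> 0 <= v x -> D (x ^+ (n * N))].
Proof.
move=> tors iso; have [phiM _ phi_ker] := iso; have [[m [m0 num]] _] := hdim.
have [q [q0 mq]] := tors (phi m).1; set k := (phi m).2.
have fst_mulrn (a : T * int) n : (a *+ n).1 = a.1 *+ n.
  by elim: n => [//|n IH]; rewrite !mulrS /= IH.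
have snd_mulrn (a : T * int) n : (a *+ n).2 = a.2 *+ n.
  by elim: n => [//|n IH]; rewrite !mulrS /= IH.
have intmulrn (a : int) n : a *+ n = a * n%:Z by rewrite -mulr_natr natz.
have ker x : x != 0 -> (phi x).1 = 0 -> (phi x).2 = 0 -> unitD D x.
  by move=> x0 h1 h2; apply/phi_ker => //; case: (phi x) h1 h2 => a b /= -> ->.
(* With k = 0 the class of [m ^+ q] would be trivial and m a unit. *)
have k0 : k != 0.
  apply/eqP => k0; case: num => Dm; apply.
  have : unitD D (m ^+ q).
    apply: ker; rewrite ?expf_neq0 // divgroup_expr ?fst_mulrn ?snd_mulrn //.
    by rewrite -/k k0 mul0rn.
  by case: q q0 {mq} => // q _; rewrite exprS; apply: unitD_mulr => //; exact: subX.
have mn0 n : m ^+ n != 0 by rewrite expf_neq0.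
(* The factor [Num.sg k] orients Z so that the nonunit m has positive value. In N, q kills the
   torsion component of m and [|k|] balances the integer components. *)
exists (fun x => Num.sg k * (phi x).2), (`|k| * q)%N; split.
- by rewrite muln_gt0 absz_gt0 k0.
- move=> x y x0 y0; rewrite phiM ?invr_eq0 // divgroup_inv //= mulrDr.
  by rewrite mulrN.
(* A negative value would make the product of a power of x and a positive power of m a unit, hence m
   a unit of D. *)
- move=> x Dx x0; rewrite leNgt; apply/negP => vx.
  have [n [n0 xn]] := tors (phi x).1.
  have u : unitD D (x ^+ (n * (`|k| * q)) * m ^+ (q * (n * `|(phi x).2|))).
    have xx0 : x ^+ (n * (`|k| * q)) != 0 by rewrite expf_neq0.
    apply: ker; first by rewrite mulf_neq0.
      rewrite phiM // !divgroup_expr //= !fst_mulrn !mulrnA xn mq.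
      by rewrite !mul0rn addr0.
    rewrite phiM // !divgroup_expr //= !snd_mulrn -/k !intmulrn !PoszM !abszE.
    have := @mulr_norm_sg _ k (- (phi x).2) k0.
    rewrite mulrN oppr_ge0 normrN mulNr => /(_ (ltW vx)) kz.
    have -> : k * (q%:Z * (n%:Z * `|(phi x).2|)) = q%:Z * n%:Z * (k * `|(phi x).2|).
      by ring.
    by rewrite -kz; ring.
  case: num => Dm; apply; move: u; rewrite mulrC.
  have : (0 < q * (n * `|(phi x).2|))%N.
    rewrite !muln_gt0 q0 n0 absz_gt0 /=; apply: contraTneq vx => ->.
    by rewrite mulr0 ltxx.
  case: (q * _)%N => // e _; rewrite exprS -mulrA.
  by apply: unitD_mulr => //; apply: subM => //; exact: subX.
- move=> x n x0 xn vx.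
  have u : unitD D (x ^+ (n * (`|k| * q)) / m ^+ (q * (n * `|(phi x).2|))).
    have xx0 : x ^+ (n * (`|k| * q)) != 0 by rewrite expf_neq0.
    apply: ker; first by rewrite mulf_neq0 ?invr_eq0.
      rewrite phiM ?invr_eq0 // divgroup_inv // !divgroup_expr //=.
      by rewrite !fst_mulrn !mulrnA xn mq !mul0rn subr0.
    rewrite phiM ?invr_eq0 // divgroup_inv // !divgroup_expr //=.
    rewrite !snd_mulrn -/k !intmulrn !PoszM !abszE.
    have -> : k * (q%:Z * (n%:Z * `|(phi x).2|)) = q%:Z * n%:Z * (k * `|(phi x).2|).
      by ring.
    by rewrite -(mulr_norm_sg k0 vx); ring.
  rewrite -(divfK (mn0 (q * (n * `|(phi x).2|))%N) (x ^+ _)); apply: subM => //.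
    by case: u.
  by apply: subX => //; case: num.
Qed.

Lemma torsion_divgroup_AV : divgroup_torsion_Z D -> AV_domain D.
Proof.
move=> [T [phi [tors iso]]] a b Da Db a0 b0.
have [v [N [N0 vB _ vD]]] := divgroup_sign tors iso.
have main x y : x != 0 -> y != 0 -> 0 <= v (x / y) ->
    exists n, (0 < n)%N /\ dvdD D (y ^+ n) (x ^+ n).
  move=> x0 y0 vxy; have [n [n0 xyn]] := tors (phi (x / y)).1.
  exists (n * N)%N; rewrite muln_gt0 n0 N0; split=> //.
  exists ((x / y) ^+ (n * N)); split; last by rewrite -exprMn divfK.
  by apply: vD => //; rewrite mulf_neq0 ?invr_eq0.
have [vab|vab] := leP 0 (v (a / b)).
  by have [n [n0 h]] := main a b a0 b0 vab; exists n; split=> //; right.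
have [|n [n0 h]] := main b a b0 a0.
  by rewrite vB // -oppr_le0 opprB -vB // ltW.
by exists n; split=> //; left.
Qed.

(** A common exponent of T makes the exponent supplied by [divgroup_sign] uniform over S, so the
    power of a member of least value divides all the others. *)
Lemma bounded_divgroup_API : divgroup_bounded_Z D -> API_domain D.
Proof.
move=> [T [phi [[n [n0 bdd]] iso]]] S SD [x0 Sx0].
have [|v [N [N0 vB v_ge0 vD]]] := divgroup_sign _ iso; first by move=> a; exists n.
have exP : exists k, `[< exists x, S x /\ `|v x|%N = k >].
  by exists `|v x0|%N; apply/asboolP; exists x0.
have [_ /asboolP[g [Sg <-]] gmin] := ex_minnP exP.
have [Dg gn0] := SD _ Sg.
exists (n * N)%N; rewrite muln_gt0 n0 N0; split=> //.
apply: (principal_ideal_gen_mem (g := g ^+ (n * N))) => //; first exact: subX.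
  by exists g.
move=> _ [x [Sx ->]]; have [Dx xn0] := SD _ Sx.
exists ((x / g) ^+ (n * N)); split; last by rewrite -exprMn divfK.
apply: vD => //; first by rewrite mulf_neq0 ?invr_eq0.
rewrite vB // subr_ge0 -[v g]ger0_norm ?v_ge0 // -[v x]ger0_norm ?v_ge0 //.
by rewrite -!abszE lez_nat; apply/gmin/asboolP; exists x.
Qed.

(** The zero module ['rV[int]_0] plays the trivial torsion group. *)
Lemma divgroup_Z_AV : divgroup_Z D -> AV_domain D.
Proof.
move=> [phi [phiM phi_surj phi_ker]]; apply: torsion_divgroup_AV.
exists 'rV[int]_0, (fun x => (0, phi x)); split.
  by move=> a; exists 1%N; split=> //; rewrite thinmx0.
split=> [x y x0 y0|[a z]|x x0]; first by rewrite phiM // -[RHS]/(0 + 0, _) addr0.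
  by have [x [x0 <-]] := phi_surj z; exists x; rewrite [a]thinmx0.
by rewrite -phi_ker //; split=> [[]|->].
Qed.

End DivisibilityGroup.

(** * Residue characteristic zero *)

(** The ring Z_(2) inside K: odd integers are inverted and 2 is not, so that every 1 + 2x is a
    unit. *)
Definition int_local2 (K : fieldType) (x : K) : Prop :=
  exists (a : int) (b : nat), odd b /\ x = a%:~R / b%:R.

Definition adjoin (K : fieldType) (R : K -> Prop) (x y : K) : Prop :=
  exists q : {poly K}, (forall i, R q`_i) /\ y = q.[x].

Lemma subring_adjoin (K : fieldType) (R : K -> Prop) (x : K) :
  subring R -> subring (adjoin R x).
Proof.
move=> hR; pose P := polyOver (subring_pred hR).
have PE (q : {poly K}) : q \in P <-> (forall i, R q`_i).
  split=> [/polyOverP h i|h]; first exact/(subring_predP hR)/h.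
  by apply/polyOverP => i; exact/(subring_predP hR).
split.
- by exists 1; rewrite hornerC; split=> //; apply/PE; exact: rpred1.
- move=> _ _ [p [/PE Rp ->]] [q [/PE Rq ->]]; exists (p - q).
  by rewrite hornerD hornerN; split=> //; apply/PE; exact: rpredB.
- move=> _ _ [p [/PE Rp ->]] [q [/PE Rq ->]]; exists (p * q).
  by rewrite hornerM; split=> //; apply/PE; exact: rpredM.
Qed.

Lemma adjoin_base (K : fieldType) (R : K -> Prop) (x a : K) :
  subring R -> R a -> adjoin R x a.
Proof.
move=> hR Ra; exists a%:P; rewrite hornerC; split=> // i.
by rewrite coefC; case: eqP => // _; exact: sub0.
Qed.

Lemma adjoin_gen (K : fieldType) (R : K -> Prop) (x : K) :
  subring R -> adjoin R x x.
Proof.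
move=> hR; exists 'X; rewrite hornerX; split=> // i.
by rewrite coefX; exact: subnat.
Qed.

Lemma adjoin_sub (K : fieldType) (R V : K -> Prop) (x y : K) :
  subring V -> (forall a, R a -> V a) -> V x -> adjoin R x y -> V y.
Proof.
by move=> hV RV Vx [q [Rq ->]]; apply: sub_horner => // i; exact: RV.
Qed.

(** The identity permutation contributes 1 modulo c; any other permutation moves some index, and the
    off-diagonal entry met there carries a factor c. *)
Lemma det_one_addZ (K : fieldType) (A : K -> Prop) n (B : 'M[K]_n) c :
  subring A -> A c -> (forall i j, A (B i j)) ->
  exists e, A e /\ \det (1%:M + c *: B) = 1 + c * e.
Proof.
move=> hA Ac AB; rewrite /determinant (bigD1 (1%g : 'S_n)) //= odd_perm1 expr0 mul1r.
have [e [Ae ->]] : exists e, A e /\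
    \prod_i (1%:M + c *: B) i ((1%g : 'S_n) i) = 1 + c * e.
  apply: (big_ind (fun t => exists e, A e /\ t = 1 + c * e)).
  - by exists 0; rewrite mulr0 addr0; split=> //; exact: sub0.
  - move=> _ _ [e [Ae ->]] [f [Af ->]]; exists (e + f + c * (e * f)).
    split; last by ring.
    by apply: subD => //; [exact: subD|apply: subM => //; exact: subM].
  - by move=> i _; exists (B i i); rewrite perm1 !mxE eqxx.
suff [f [Af ->]] : exists f, A f /\ \sum_(s | s != (1%g : 'S_n))
    (-1) ^+ odd_perm s * \prod_i (1%:M + c *: B) i (s i) = c * f.
  by exists (e + f); split; [exact: subD|rewrite mulrDr addrA].
apply: (big_ind (fun t => exists e, A e /\ t = c * e)) => [|_ _ [f [Af ->]] [h [Ah ->]]|s s1].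
- by exists 0; rewrite mulr0; split=> //; exact: sub0.
- by exists (f + h); rewrite mulrDr; split=> //; exact: subD.
have [i si] : exists i, i != s i.
  apply/existsP; apply: contraNT s1 => /existsPn s1.
  by apply/eqP/permP => i; rewrite perm1; apply/esym/eqP/negPn/s1.
exists ((-1) ^+ odd_perm s * (B i (s i) * \prod_(j | j != i) (1%:M + c *: B) j (s j))).
split; last first.
  by rewrite (bigD1 i) //= 3!mxE (negPf si) add0r -mulrA [LHS]mulrCA.
have A1 : A (-1) by apply: subN => //; exact: sub1.
apply: subM => //; first exact: (subX hA).
apply: subM => //; apply: (big_ind A) => [|y z|j _]; [exact: sub1|exact: subM|].
by rewrite !mxE; apply: subD => //; [exact: subnat|exact: subM].
Qed.

Section ResidueCharZero.
Variables (K : fieldType) (D : K -> Prop).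
Hypotheses (hD : subring D).
Hypothesis hchar : forall n, (0 < n)%N -> unitD D n%:R.
Hypothesis hbarl : quasi_local (intcl D).

Let V := intcl D.
Let hV : subring V. Proof. exact: subring_intcl. Qed.
Let DV x : D x -> V x. Proof. exact: sub_intcl. Qed.
Let Z2 : K -> Prop := @int_local2 K.

Let nat_neq0 n : (0 < n)%N -> n%:R != 0 :> K.
Proof. by move/hchar; case. Qed.

Let odd_neq0 n : odd n -> n%:R != 0 :> K.
Proof. by move=> on; apply: nat_neq0; case: n on. Qed.

Lemma subring_int_local2 : subring Z2.
Proof.
split.
- by exists 1, 1%N; rewrite divr1.
- move=> _ _ [a [b [ob ->]]] [c [d [od ->]]].
  exists (a * d%:Z - c * b%:Z), (b * d)%N; rewrite oddM ob od; split=> //.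
  rewrite natrM intrB !intrM -!pmulrn.
  by field; rewrite !odd_neq0.
- move=> _ _ [a [b [ob ->]]] [c [d [od ->]]].
  exists (a * c), (b * d)%N; rewrite oddM ob od; split=> //.
  by rewrite natrM intrM; field; rewrite !odd_neq0.
Qed.

Let hZ2 := subring_int_local2.

Lemma int_local2_sub x : Z2 x -> D x.
Proof.
move=> [a [b [ob ->]]]; apply: subM => //.
  by case: a => n; rewrite ?NegzE ?mulrNz; [|apply: subN => //]; exact: subnat.
by have [] := hchar (_ : 0 < b)%N; case: b ob.
Qed.

Lemma int_local2_inv x : Z2 x -> Z2 (1 + 2 * x)^-1 /\ 1 + 2 * x != 0.
Proof.
move=> [a [b [ob ->]]].
have b0 := odd_neq0 ob.
have E : 1 + 2 * (a%:~R / b%:R) = (b%:Z + 2 * a)%:~R / b%:R :> K.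
  by rewrite intrD intrM -pmulrn; field.
(* The integer b + 2a is odd but may be negative. Denominators are natural numbers, so its sign has
   to move to the numerator of the inverse. *)
have [n [s [on cE]]] : exists (n : nat) (s : bool),
    odd n /\ b%:Z + 2 * a = (-1) ^+ s * n%:Z.
  exists `|(b%:Z + 2 * a)%R|%N, (b%:Z + 2 * a < 0); split; last first.
    by rewrite abszE -intEsign.
  lia.
have n0 := odd_neq0 on.
have c0 : (b%:Z + 2 * a)%:~R != 0 :> K.
  by rewrite cE rmorphM rmorph_sign /= -pmulrn mulf_neq0 // signr_eq0.
rewrite E; split; last by rewrite mulf_neq0 ?invr_eq0.
exists ((-1) ^+ s * b%:Z), n; split=> //.
rewrite cE !rmorphM !rmorph_sign /= -!pmulrn invf_div invfM invr_sign.
by field.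
Qed.

(* 4^(i+1) / (i+2) is even since the 2-adic valuation of i+2 is at most i+1. *)
Lemma four_pow_div i : exists r, Z2 r /\ 4 ^+ i.+1 / i.+2%:R = 2 * r.
Proof.
have [b cb bE] := pfactor_coprime (isT : prime 2) (ltn0Sn i.+1).
set k := logn 2 i.+2 in bE.
have ki : (k <= i.+1)%N.
  rewrite -ltnS -(ltn_exp2l _ _ (isT : 1 < 2)%N).
  apply: leq_ltn_trans (ltn_expl i.+2 (isT : 1 < 2)%N).
  by rewrite [X in (_ <= X)%N]bE leq_pmull //; case: b cb {bE}.
have ob : odd b by rewrite coprime2n in cb.
exists ((2 ^ (i.+1 + i - k))%N%:Z%:~R / b%:R); split; first by exists (2 ^ (i.+1 + i - k))%N, b.
have -> : i.+2%:R = b%:R * 2 ^+ k :> K by rewrite bE natrM natrX.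
have -> : 4 = 2 ^+ 2 :> K by rewrite -natrX.
have -> : (2 ^+ 2) ^+ i.+1 = 2 * 2 ^+ (i.+1 + i - k) * 2 ^+ k :> K.
  by rewrite -exprM -exprS -exprD; congr (_ ^+ _); lia.
rewrite -pmulrn natrX; field.
by rewrite odd_neq0 //= expf_neq0 // (nat_neq0 (isT : 0 < 2)%N).
Qed.

(** After division by 4(m + 1), the binomial term of degree i + 2 has coefficient C(m, i + 1)
    4^(i+1) / (i + 2), which is even. With 2 in place of 4, the factor for i = 0 would be 2/2 = 1;
    this is why 4 is used. *)
Lemma pow_one_add4 (z : K) m : exists w, adjoin Z2 z w /\
  (1 + 4 * z) ^+ m.+1 - 1 = (4 * m.+1)%:R * (z + 2 * w).
Proof.
have hA : subring (adjoin Z2 z) := subring_adjoin z hZ2.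
have [w [Aw wE]] : exists w, adjoin Z2 z w /\
    \sum_(i < m) (4 * z) ^+ i.+2 *+ 'C(m.+1, i.+2) = (4 * m.+1)%:R * (2 * w).
  apply: (big_ind (fun t => exists w, adjoin Z2 z w /\ t = (4 * m.+1)%:R * (2 * w))).
  - by exists 0; rewrite !mulr0; split=> //; exact: sub0.
  - move=> _ _ [u [Au ->]] [w [Aw ->]]; exists (u + w); split; first exact: subD.
    by rewrite !mulrDr.
  - move=> i _; have [r [Zr rE]] := four_pow_div i.
    exists ('C(m, i.+1)%:R * r * z ^+ i.+2); split.
      apply: subM => //; last by apply: subX => //; exact: adjoin_gen.
      by apply: subM => //; [exact: subnat|exact: adjoin_base].
    have binE : m.+1%:R * 'C(m, i.+1)%:R = i.+2%:R * 'C(m.+1, i.+2)%:R :> K.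
      by rewrite -!natrM (mul_bin_diag m.+1 i.+1).
    have -> : (4 * m.+1)%:R * (2 * ('C(m, i.+1)%:R * r * z ^+ i.+2)) =
        4 * (m.+1%:R * 'C(m, i.+1)%:R) * (2 * r) * z ^+ i.+2 by rewrite natrM; ring.
    rewrite binE -rE exprMn -mulr_natr [4 ^+ i.+2]exprS.
    by field; rewrite -natrD nat_neq0.
exists w; split=> //; rewrite addrC exprDn.
under eq_bigr do rewrite expr1n mul1r.
rewrite 2!big_ord_recl /= [X in _ + (_ + (_ + X))]wE bin1 natrM.
by rewrite expr0 bin0 mulr1n expr1 -mulr_natr; ring.
Qed.

(** The root property is applied to 1 + 4z rather than to z; division by 4(m + 1), a unit of D, then
    isolates z modulo 2. *)
Lemma root_ext_mod2 (z : K) : root_ext D V -> V z ->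
  exists a w, [/\ D a, adjoin Z2 z w & z = a + 2 * w].
Proof.
move=> hroot Vz; have [|[|m] [// _ Dm]] := hroot (1 + 4 * z).
  by apply: (subD hV); [exact: sub1|apply: (subM hV) => //; exact: subnat].
have [w [Aw wE]] := pow_one_add4 z m; exists (z + 2 * w), (- w).
have [_ m0 Dmi] : unitD D (4 * m.+1)%:R by exact: hchar.
split; last by ring.
  have -> : z + 2 * w = ((1 + 4 * z) ^+ m.+1 - 1) / (4 * m.+1)%:R.
    by rewrite wE mulrAC divff // mul1r.
  by apply: subM => //; apply: subB => //; exact: sub1.
by apply: subN => //; exact: subring_adjoin.
Qed.

(* Nakayama's lemma for Z_(2)[x] / (D meet Z_(2)[x]) and multiplication by 2. *)
Lemma root_ext_nakayama (x : K) : root_ext D V -> V x ->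
  exists e, [/\ adjoin Z2 x e, D (1 + 2 * e) & D ((1 + 2 * e) * x)].
Proof.
move=> hroot Vx; have [n [n0 Dxn]] := hroot x Vx.
have hR : subring (adjoin Z2 x) := subring_adjoin x hZ2.
have Rx : adjoin Z2 x x by exact: adjoin_gen.
pose A y := D y /\ adjoin Z2 x y.
have hA : subring A.
  split=> [|y z [Dy Ry] [Dz Rz]|y z [Dy Ry] [Dz Rz]].
  - by split; exact: sub1.
  - by split; exact: subB.
  - by split; exact: subM.
(* Since [x ^+ n] is in A, exponents below n would span; the extra one makes x itself available at
   index 1 even when n = 1. *)
pose s := mkseq (fun i => x ^+ i) n.+1.
have Rs y : adjoin Z2 x y -> dspan A s y.
  move=> [q [Zq ->]]; rewrite horner_coef; apply: dspan_sum => // i _.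
  apply: dspan_scale => //; first by split; [exact: int_local2_sub|exact: adjoin_base].
  rewrite (divn_eq i n) exprD mulnC exprM; apply: dspan_scale => //.
    by apply: subX => //; split=> //; exact: subX.
  apply: mem_dspan => //; apply/(nthP 0); exists (i %% n)%N.
    by rewrite size_mkseq ltnS ltnW // ltn_mod.
  by rewrite nth_mkseq // ltnS ltnW // ltn_mod.
have /choice[f fP] (i : 'I_n.+1) : exists ab : K * (nat -> K), [/\ D ab.1,
    forall j, A (ab.2 j) & x ^+ i = ab.1 + 2 * \sum_(j < n.+1) ab.2 j * x ^+ j].
  have [a [w [Da Aw wE]]] := root_ext_mod2 hroot (subX hV i Vx).
  have /Rs/(dspanP hA)[b [Ab bE]] : adjoin Z2 x w.
    apply: adjoin_sub Aw => //; last exact: subX.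
    by move=> *; exact: adjoin_base.
  exists (a, b); split=> //=; rewrite wE bE size_mkseq; congr (_ + _ * _).
  by apply: eq_bigr => j _; rewrite nth_mkseq.
pose B := \matrix_(i < n.+1, j < n.+1) (- (f i).2 j).
have AB i j : A (B i j) by rewrite mxE; apply: subN => //; case: (fP i).
have A2 : A 2 by exact: subnat.
have [e [[De Re] eE]] := det_one_addZ hA A2 AB.
set M := 1%:M + 2 *: B in eE.
have AM i j : A (M i j).
  rewrite !mxE; apply: subD => //; first exact: subnat.
  by apply: subM => //; have := AB i j; rewrite mxE.
exists e; split=> //.
  by apply: subD => //; [exact: sub1|apply: subM => //; exact: subnat].
have Mv : M *m (\col_i x ^+ i) = \col_i (f i).1.
  apply/colP => i; rewrite mulmxDl mul1mx -scalemxAl !mxE.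
  have [_ _ ->] := fP i; rewrite -addrA -mulrDr -big_split big1 ?mulr0 ?addr0 //=.
  by move=> j _; rewrite !mxE mulNr subrr.
(* Multiplying by the adjugate and reading off entry 1 gives (1 + 2e) x as a combination of the
   elements [(f i).1] of D with coefficients in D. *)
have := congr1 (fun v => (\adj M *m v) (inord 1) 0) Mv.
rewrite mulmxA mul_adj_mx eE mul_scalar_mx !mxE inordK ?ltnS // expr1 => ->.
apply: sub_sum => // j _; rewrite !mxE; apply: subM => //; last by case: (fP j).
rewrite /cofactor; apply: subM => //.
  by apply: subX => //; apply: subN => //; exact: sub1.
by apply: sub_det => // k l; rewrite 2!mxE; case: (AM (lift j k) (lift (inord 1) l)).
Qed.

(* 2 stays a nonunit in Z_(2)[x] or in Z_(2)[1/x] modulo the maximal ideal: a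
   relation 1 + 2 g(1/x) = 0 rewrites x^m in terms of lower powers, which
   lowers the degree in a relation 1 + 2 f(x) = 0. *)
Lemma int_local2_lies_below (x : K) (f g : {poly K}) : unitD V x ->
  (forall i, Z2 f`_i) -> (forall i, Z2 g`_i) ->
  nonunitD V (1 + 2 * f.[x]) -> nonunitD V (1 + 2 * g.[x^-1]) -> False.
Proof.
have [N] := ubnP (size f + size g); elim: N x f g => // N IH.
(* Exchanging x with [x^-1] exchanges f and g, so f may be taken as the longer polynomial. *)
suff step x (f g : {poly K}) : (size g <= size f)%N ->
    (size f + size g < N.+1)%N -> unitD V x ->
    (forall i, Z2 f`_i) -> (forall i, Z2 g`_i) ->
    nonunitD V (1 + 2 * f.[x]) -> nonunitD V (1 + 2 * g.[x^-1]) -> False.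
  move=> x f g sN ux Zf Zg nf ng.
  have [gf|/ltnW fg] := leqP (size g) (size f); first exact: (step x f g).
  apply: (step x^-1 g f) => //; rewrite ?invrK //; first by rewrite addnC.
  exact: unitDV.
move=> gf sN ux Zf Zg nf ng; have [_ _ hlA hlZ] := hbarl.
have [Vx x0 _] := ux.
case sf : (size f) gf sN => [|m] gf sN.
  move/eqP: sf; rewrite size_poly_eq0 => /eqP f0.
  by case: nf => _; apply; rewrite f0 horner0 mulr0 addr0; exact: unitD1.
have [Zu u0] := int_local2_inv (Zg 0%N); set u := 1 + 2 * g`_0 in Zu u0.
(* The choice c u = 2 f_m makes subtraction of c x^m (1 + 2 g(1/x)) cancel the term of degree m in 2
   f(x). Since g has at most m + 1 coefficients, x^m g(1/x) is a polynomial in x. *)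
pose c := 2 * u^-1 * f`_m.
have Zc : Z2 c by apply: subM => //; apply: subM => //; exact: subnat.
pose f' := \poly_(k < m) (f`_k - c * g`_(m - k)).
apply: (IH x f' g) => //.
- by have := size_poly m (fun k => f`_k - c * g`_(m - k)); rewrite -/f'; lia.
- move=> i; rewrite coef_poly; case: ifP => _; last exact: sub0.
  by apply: subB => //; exact: subM.
have xg : x ^+ m * g.[x^-1] = g`_0 * x ^+ m + \sum_(k < m) g`_(m - k) * x ^+ k.
  rewrite (horner_coef_wide _ gf) mulr_sumr (reindex_inj rev_ord_inj) /=.
  rewrite big_ord_recr addrC /= subnn expr0 mulr1 mulrC; congr (_ + _).
  apply: eq_bigr => -[k /= km] _; rewrite subSS mulrCA exprVn.
  by congr (_ * _); rewrite -{1}(subnKC (ltnW km)) exprD mulfK ?expf_neq0.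
suff -> : 1 + 2 * f'.[x] = (1 + 2 * f.[x]) + (- c * x ^+ m) * (1 + 2 * g.[x^-1]).
  apply: hlA => //; apply: hlZ => //; apply: (subM hV); last exact: (subX hV).
  by apply: (subN hV); apply/DV/int_local2_sub.
have -> : (- c * x ^+ m) * (1 + 2 * g.[x^-1]) =
    - c * (x ^+ m + 2 * (x ^+ m * g.[x^-1])) by ring.
rewrite xg horner_poly horner_coef sf big_ord_recr /=.
under eq_bigr do rewrite mulrBl -mulrA.
rewrite sumrB -mulr_sumr /c /u.
by field.
Qed.

Lemma root_ext_intcl_eq : root_ext D V -> V = D.
Proof.
move=> hroot; apply/predeqP => x; split; last exact: DV.
have unit_or y : unitD V y -> D y \/
    exists q : {poly K}, (forall i, Z2 q`_i) /\ nonunitD V (1 + 2 * q.[y]).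
  move=> [Vy y0 _]; have [e [[q [Zq ->]] De Dey]] := root_ext_nakayama hroot Vy.
  have [ue|nue] := pselect (unitD V (1 + 2 * q.[y])).
    left; have [_ e0 Dei] := proj1 (unitD_intcl hD De) ue.
    by rewrite -(mulKf e0 y); exact: subM.
  by right; exists q; split=> //; split=> //; exact: DV.
have unitP y : unitD V y -> D y.
  move=> uy; have [//|[f [Zf nf]]] := unit_or y uy.
  have [Dyi|[g [Zg ng]]] := unit_or y^-1 (unitDV uy).
    rewrite -[y]invrK; apply: intcl_inv => //; last by rewrite invrK; case: uy.
    by rewrite invr_eq0; case: uy.
  by case: (int_local2_lies_below uy Zf Zg nf ng).
move=> Vx; have [/unitP//|nux] := pselect (unitD V x).
(* A nonunit x is reached through the unit 1 + x. *)
rewrite -(addKr 1 x); apply: subD => //; first by apply: subN => //; exact: sub1.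
by apply/unitP/unitD_add => //; exact: unitD1.
Qed.

End ResidueCharZero.

(** * The equivalences *)

Theorem theorem9 (K : fieldType) (D : K -> Prop)
  (hsub : subring D) (hfrac : is_frac_field D)
  (hnoeth : noetherian D) (hloc : quasi_local D) (hdim : one_dimensional D)
  (hbarloc : quasi_local (intcl D)) (hfin : fin_gen_module D (intcl D)) :
  ((forall n : nat, (0 < n)%N -> ~ nonunitD D (n%:R : K)) ->
     [<-> AV_domain D; API_domain D; DVR D; divgroup_Z D])
  /\
  (forall p : nat, prime p -> nonunitD D (p%:R : K) ->
     [<-> AV_domain D; root_ext D (intcl D); residue_root_ext D;
          divgroup_torsion_Z D]
     /\
     [<-> API_domain D; bounded_root_ext D (intcl D);
          residue_bounded_root_ext D; divgroup_bounded_Z D]).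
Proof.
have hV : subring (intcl D) by exact: subring_intcl.
have APItoAV : API_domain D -> AV_domain D by exact: API_AV.
have AVroot : AV_domain D -> root_ext D (intcl D) by exact: AV_root_ext.
split=> [hchar|p pp nup].
  have AVtoDVR : AV_domain D -> DVR D.
    move=> hAV; have [t ht] := intcl_uniformizer hsub hfrac hnoeth hdim hbarloc hfin.
    have VD : intcl D = D.
      apply: root_ext_intcl_eq => //; last exact: AVroot.
      move=> n n0; apply: contrapT => nu; apply: (hchar n n0).
      by split=> //; exact: subnat.
    by move: ht; rewrite VD => ht; exact: (uniformizer_DVR hsub hnoeth ht).
  tfae.
  - by move/AVtoDVR => hDVR; exact: DVR_API.
  - by move/APItoAV/AVtoDVR.
  - by move=> hDVR; exact: DVR_divgroup_Z.
  - exact: divgroup_Z_AV.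
split.
  tfae.
  - exact: AVroot.
  - exact: root_residue.
  (* The residue characteristic p enters here, in lifting powers from the residue field. *)
  - by move/(residue_root hsub hfrac hnoeth hdim hbarloc hfin pp nup); exact: root_divgroup.
  - exact: torsion_divgroup_AV.
tfae.
- exact: API_bounded_root_ext.
- exact: bounded_root_residue.
- by move/(residue_bounded_root hsub hfrac hnoeth hdim hbarloc hfin pp nup);
    exact: bounded_root_divgroup.
- exact: bounded_divgroup_API.
Qed.
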